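(* Suppose that the conditional distribution of $(X,H)$ given $Y=y$ is that of the mixed normal/Ising model described in the context. Let $$t(X,H)=\big(X^T,\ H^T,\ [J_q\,\mathrm{vech}(HH^T)]^T\big)^T,\qquad b=\begin{pmatrix}\Delta^{-1}A\\ L_q\tau-\beta^T\Delta^{-1}A\\ J_q\tau\end{pmatrix},$$ and let $\alpha_b$ be a matrix whose columns form a basis of $\mathrm{span}(b)$ (the column space of $b$). Then $$R(X,H)=\alpha_b^T\big(t(X,H)-E(t(X,H))\big)$$ is a minimal sufficient dimension reduction for the regression of $Y$ on $(X,H)$.
   Context: Setting. $Y$ is a (continuous or categorical) random response, $X$ is a random vector in $\mathbb{R}^p$, $H$ is a random vector in $\{0,1\}^q$, and $Z=(X^T,H^T)^T$. $f_Y\in\mathbb{R}^r$ is a known function of $Y$, centered so that $E(f_Y)=0$; $f_y$ denotes its value at $Y=y$. Matrix notation. $k_q=q(q-1)/2$. For a square matrix $G$, $\mathrm{vech}(G)$ stacks the columns of the lower triangular part of $G$ including the diagonal. $L_q\in\{0,1\}^{q\times q(q+1)/2}$ and $J_q\in\{0,1\}^{k_q\times q(q+1)/2}$ are the selection matrices extracting from $\mathrm{vech}(G)$ the diagonal entries, respectively the off-diagonal entries, of a symmetric $q\times q$ matrix $G$ (in the order of $\mathrm{vech}$). Model. Parameters: $\Delta$ a $p\times p$ positive definite matrix, $A\in\mathbb{R}^{p\times r}$, $\beta\in\mathbb{R}^{p\times q}$, $\mu_X=E(X)$, $\mu_H=E(H)$, $\tau_0\in\mathbb{R}^{q(q+1)/2}$,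 $\tau\in\mathbb{R}^{q(q+1)/2\times r}$. The conditional law of $(X,H)$ given $Y=y$ is: $X\mid(H,Y=y)\sim N(\mu_X+Af_y+\beta(H-\mu_H),\Delta)$ and $P(H=h\mid Y=y)=G_y^{-1}\exp\{\mathrm{vech}(hh^T)^T(\tau_0+\tau f_y)\}$ for $h\in\{0,1\}^q$, with $G_y=\sum_{h\in\{0,1\}^q}\exp\{\mathrm{vech}(hh^T)^T(\tau_0+\tau f_y)\}$. Definitions. A function $R$ of $Z$ is a sufficient (dimension) reduction for the regression of $Y$ on $Z$ if the conditional distribution of $Y$ given $Z$ equals that of $Y$ given $R(Z)$ (equivalently, $Z\mid(Y,R(Z))$ has the same distribution as $Z\mid R(Z)$). It is minimal if it is (almost surely) a function of every other sufficient reduction.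
   Formalization: The formal theorem adds that no nonzero linear combination of the coordinates of f_Y vanishes almost surely; without this (e.g. f_Y = 0 with A nonzero) Y is independent of (X,H), a constant is sufficient, and R is not minimal. *)

(* Defs.v *)
From HB Require Import structures.
From mathcomp Require Import all_boot all_order all_algebra.
From mathcomp Require Import zify.
From mathcomp Require Import all_classical all_reals all_analysis.
From mathcomp Require Import measurable_realfun.

Set Implicit Arguments.
Unset Strict Implicit.
Unset Printing Implicit Defensive.

Import Order.TTheory GRing.Theory Num.Theory.
Import numFieldNormedType.Exports.

Local Open Scope classical_set_scope.
Local Open Scope ring_scope.

Definition posdef (R : realType) (n : nat) (D : 'M[R]_n) : Prop :=
  D^T = D /\ forall v : 'cV[R]_n, v != 0 -> 0 < (v^T *m D *m v) 0 0.

(* Index pairs (row, column) of the lower triangle, column by column, with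
   (resp. without) the diagonal. *)
Definition vech_seq (q : nat) : seq ('I_q * 'I_q) :=
  [seq (i, j) | j : 'I_q <- enum 'I_q,
                i : 'I_q <- [seq i : 'I_q <- enum 'I_q | (j <= i)%N]].

Definition off_seq (q : nat) : seq ('I_q * 'I_q) :=
  [seq (i, j) | j : 'I_q <- enum 'I_q,
                i : 'I_q <- [seq i : 'I_q <- enum 'I_q | (j < i)%N]].

Definition dim_vech (q : nat) : nat := (q * q.+1)./2.
Definition dim_off (q : nat) : nat := (q * q.-1)./2.

Lemma size_filter_enum_ord (q m : nat) :
  size [seq i : 'I_q <- enum 'I_q | (m <= i)%N] = (q - m)%N.
Proof.
rewrite size_filter -(count_map val (fun i => m <= i)%N) val_enum_ord.
have -> : iota 0 q = index_iota 0 q by rewrite /index_iota subn0.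
rewrite -sum1_count big_mkord.
elim: q => [|q IH]; first by rewrite big_ord0.
rewrite big_mkcond big_ord_recr -big_mkcond /= IH.
case: leqP => ? /=; lia.
Qed.

Lemma sum_ord_rev (q : nat) (F : nat -> nat) :
  (\sum_(i < q) F (q - i.+1) = \sum_(i < q) F i)%N.
Proof.
rewrite (reindex_inj rev_ord_inj) /=; apply: eq_bigr => i _.
by rewrite subnSK // subKn // ltnW.
Qed.

Lemma size_vech_seq (q : nat) : size (vech_seq q) == dim_vech q.
Proof.
rewrite /vech_seq size_allpairs_dep sumnE big_map big_enum /=.
rewrite (eq_bigr (fun j : 'I_q => (q - j.+1).+1)); last first.
  by move=> j _; rewrite size_filter_enum_ord subnSK.
rewrite (sum_ord_rev q succn) /dim_vech.
have := bin2_sum q.+1; rewrite big_nat_recl // big_mkord add0n => ->.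
by rewrite bin2 mulnC.
Qed.

Lemma size_off_seq (q : nat) : size (off_seq q) == dim_off q.
Proof.
rewrite /off_seq size_allpairs_dep sumnE big_map big_enum /=.
rewrite (eq_bigr (fun j : 'I_q => (q - j.+1)%N)); last first.
  by move=> j _; rewrite size_filter_enum_ord.
rewrite (sum_ord_rev q id) /dim_off -bin2.
by rewrite -bin2_sum big_mkord.
Qed.

Definition vech_pairs (q : nat) : (dim_vech q).-tuple ('I_q * 'I_q) :=
  Tuple (size_vech_seq q).
Definition off_pairs (q : nat) : (dim_off q).-tuple ('I_q * 'I_q) :=
  Tuple (size_off_seq q).

Definition vech (R : realType) (q : nat) (G : 'M[R]_q) : 'cV[R]_(dim_vech q) :=
  \col_k G (tnth (vech_pairs q) k).1 (tnth (vech_pairs q) k).2.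

Definition Lmx (R : realType) (q : nat) : 'M[R]_(q, dim_vech q) :=
  \matrix_(i, k) (tnth (vech_pairs q) k == (i, i))%:R.

Definition Jmx (R : realType) (q : nat) : 'M[R]_(dim_off q, dim_vech q) :=
  \matrix_(l, k) (tnth (vech_pairs q) k == tnth (off_pairs q) l)%:R.

(* R^n and {0,1}^n are represented as measurable spaces by n.-tuple R and
   n.-tuple bool; the two maps below read their elements as column vectors. *)
Definition colR (R : realType) (n : nat) (x : n.-tuple R) : 'cV[R]_n :=
  \col_i tnth x i.

Definition colB (R : realType) (n : nat) (h : n.-tuple bool) : 'cV[R]_n :=
  \col_i (tnth h i)%:R.

Section lebesgue_step.
Context (R : realType) (n : nat).

Definition tuple_cons (xt : measurableTypeR R * n.-tuple R) : n.+1.-tuple R :=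
  [tuple of (xt.1 : R) :: xt.2].

Lemma measurable_tuple_cons :
  measurable_fun [set: measurableTypeR R * n.-tuple R] tuple_cons.
Proof.
apply: (@measurable_cons _ _ _ _ (fun xt => xt.1 : R) n (fun xt => xt.2)).
  exact: measurable_fst.
exact: measurable_snd.
Qed.

Definition tuple_uncons (t : n.+1.-tuple R) : measurableTypeR R * n.-tuple R :=
  (thead t, [tuple of behead t]).

Lemma measurable_tuple_uncons :
  measurable_fun [set: n.+1.-tuple R] tuple_uncons.
Proof.
have m1 : measurable_fun [set: n.+1.-tuple R]
    (fun t => tnth t ord0 : measurableTypeR R) by exact: measurable_tnth.
exact: (measurable_fun_pair m1 (@measurable_behead _ R n)).
Qed.

Lemma tuple_consK : cancel tuple_cons tuple_uncons.
Proof.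
move=> [x t]; rewrite /tuple_uncons /tuple_cons /thead /= tnth0.
by congr (_, _); exact: val_inj.
Qed.

Lemma tuple_unconsK : cancel tuple_uncons tuple_cons.
Proof. by move=> t; rewrite [RHS]tuple_eta. Qed.

Context (mu : {sigma_finite_measure set (n.-tuple R) -> \bar R}).

Definition lebesgue_step : set (n.+1.-tuple R) -> \bar R :=
  pushforward (@lebesgue_measure R \x mu)%E tuple_cons.

Let lebesgue_step0 : lebesgue_step set0 = 0%E.
Proof. by rewrite /lebesgue_step /pushforward preimage_set0 measure0. Qed.

Let lebesgue_step_ge0 A : (0 <= lebesgue_step A)%E.
Proof. by rewrite /lebesgue_step /pushforward; exact: measure_ge0. Qed.

Let lebesgue_step_sigma_additive : semi_sigma_additive lebesgue_step.
Proof.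
move=> F mF tF mUF; rewrite /lebesgue_step /pushforward preimage_bigcup.
apply: measure_semi_sigma_additive.
- by move=> k; rewrite -[X in measurable X]setTI; exact: measurable_tuple_cons.
- apply/trivIsetP => /= i j _ _ ij; rewrite -preimage_setI.
  by move/trivIsetP : tF => /(_ _ _ _ _ ij) ->//; rewrite preimage_set0.
- rewrite -preimage_bigcup -[X in measurable X]setTI.
  exact: measurable_tuple_cons.
Qed.

HB.instance Definition _ := isMeasure.Build _ _ _ lebesgue_step
  lebesgue_step0 lebesgue_step_ge0 lebesgue_step_sigma_additive.

Let lebesgue_step_sigma_finite : sigma_finite setT lebesgue_step.
Proof.
have /sigma_finiteP[F [TF ndF Foo]] := sigma_finiteT (@lebesgue_measure R).
have /sigma_finiteP[G [TG ndG Goo]] := sigma_finiteT mu.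
exists (fun k => tuple_uncons @^-1` (F k `*` G k)).
  rewrite -preimage_bigcup -[LHS](preimage_setT tuple_uncons) -setXTT TF TG.
  congr (_ @^-1` _); rewrite predeqE => -[x y]; split.
    move=> [/= [i _ Fix] [j _ Gjy]]; exists (maxn i j) => //; split.
    - by move: x Fix; exact/subsetPset/ndF/leq_maxl.
    - by move: y Gjy; exact/subsetPset/ndG/leq_maxr.
  by move=> [i _ []/= ? ?]; split; exists i.
move=> k; have [mF Fk] := Foo k; have [mG Gk] := Goo k; split.
  rewrite -[X in measurable X]setTI; apply: measurable_tuple_uncons => //.
  exact: measurableX.
rewrite /lebesgue_step /pushforward -comp_preimage.
rewrite (_ : _ \o _ = id); last by apply/funext => x; exact: tuple_consK.
by rewrite preimage_id product_measure1E// lte_mul_pinfty// ge0_fin_numE.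
Qed.

HB.instance Definition _ := Measure_isSigmaFinite.Build _ _ _ lebesgue_step
  lebesgue_step_sigma_finite.

End lebesgue_step.

(* Lebesgue measure on R^n, as an iterated product of the one on R. *)
Fixpoint lebesgue_tuple (R : realType) (n : nat) :
    {sigma_finite_measure set (n.-tuple R) -> \bar R} :=
  match n with
  | 0 => \d_[tuple]
  | n'.+1 => lebesgue_step (lebesgue_tuple R n')
  end.

Definition mvnormal_pdf (R : realType) (n : nat) (m : 'cV[R]_n) (D : 'M[R]_n)
    (x : 'cV[R]_n) : R :=
  (Num.sqrt ((pi *+ 2) ^+ n * \det D))^-1 *
  expR (- ((x - m)^T *m invmx D *m (x - m)) 0 0 / 2).

Definition mvnormal (R : realType) (n : nat) (m : 'cV[R]_n) (D : 'M[R]_n)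
    (C : set (n.-tuple R)) : \bar R :=
  (\int[lebesgue_tuple R n]_(x in C) (mvnormal_pdf m D (colR x))%:E)%E.

Definition ising_weight (R : realType) (q : nat) (theta : 'cV[R]_(dim_vech q))
    (h : q.-tuple bool) : R :=
  expR (((vech (colB R h *m (colB R h)^T))^T *m theta) 0 0).

Definition ising_pmf (R : realType) (q : nat) (theta : 'cV[R]_(dim_vech q))
    (h : q.-tuple bool) : R :=
  (\sum_(g : q.-tuple bool) ising_weight theta g)^-1 * ising_weight theta h.

Definition ising (R : realType) (q : nat) (theta : 'cV[R]_(dim_vech q))
    (C : set (q.-tuple bool)) : \bar R :=
  (\sum_(h : q.-tuple bool | h \in C) ising_pmf theta h)%:E.

Definition mean_vec d (T : measurableType d) (R : realType)
    (P : probability T R) (n : nat) (V : T -> 'cV[R]_n) : 'cV[R]_n :=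
  \col_i fine ('E_P[(fun w => V w i 0)%R])%E.

(* Finiteness of the extended-real expectations makes every (measurable)
   coordinate of V integrable. *)
Definition is_mean d (T : measurableType d) (R : realType)
    (P : probability T R) (n : nat) (V : T -> 'cV[R]_n) (mu : 'cV[R]_n) : Prop :=
  forall i, ('E_P[(fun w => V w i 0)%R] = (mu i 0)%:E)%E.

(* K is a version of the conditional distribution of U given V: K v A is
   P (U \in A | V = v). *)
Definition is_cond_distr d dU dV (T : measurableType d) (TU : measurableType dU)
    (TV : measurableType dV) (R : realType) (P : probability T R)
    (U : T -> TU) (V : T -> TV) (K : TV -> set TU -> \bar R) : Prop :=
  forall A : set TU, measurable A ->
    measurable_fun [set: TV] (K ^~ A) /\
    forall B : set TV, measurable B ->
      P (U @^-1` A `&` V @^-1` B) = (\int[P]_(w in V @^-1` B) K (V w) A)%E.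

(* "Conditional distribution of Y given Z equals that of Y given S (Z)" is
   stated with regular conditional distributions (probability kernels). *)
Section reductions.
Context d dY dZ (T : measurableType d) (TY : measurableType dY)
  (TZ : measurableType dZ) (R : realType) (P : probability T R)
  (Y : T -> TY) (Z : T -> TZ).

Definition sufficient_reduction dS (TS : measurableType dS) (S : TZ -> TS) :
    Prop :=
  measurable_fun [set: TZ] S /\
  exists (K : R.-pker TZ ~> TY) (K' : R.-pker TS ~> TY),
    [/\ is_cond_distr P Y Z (fun z => K z),
        is_cond_distr P Y (S \o Z) (fun s => K' s) &
        {ae P, forall w, forall B : set TY, measurable B ->
          K (Z w) B = K' (S (Z w)) B}].

Definition minimal_sufficient_reduction dS (TS : measurableType dS)
    (S : TZ -> TS) : Prop :=
  sufficient_reduction S /\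
  forall dS' (TS' : measurableType dS') (S' : TZ -> TS'),
    sufficient_reduction S' ->
    exists g : TS' -> TS,
      measurable_fun [set: TS'] g /\
      {ae P, forall w, S (Z w) = g (S' (Z w))}.

End reductions.

Definition tstat (R : realType) (p q : nat)
    (z : p.-tuple R * q.-tuple bool) : 'cV[R]_(p + (q + dim_off q)) :=
  col_mx (colR z.1)
    (col_mx (colB R z.2) (Jmx R q *m vech (colB R z.2 *m (colB R z.2)^T))).

Definition bmx (R : realType) (p q r : nat) (Delta : 'M[R]_p) (A : 'M[R]_(p, r))
    (beta : 'M[R]_(p, q)) (tau : 'M[R]_(dim_vech q, r)) :
    'M[R]_(p + (q + dim_off q), r) :=
  col_mx (invmx Delta *m A)
    (col_mx (Lmx R q *m tau - beta^T *m invmx Delta *m A) (Jmx R q *m tau)).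

(* The columns of a form a basis of the column space of b; the library's rank
   and span notions are about rows, hence the transposes. *)
Definition is_col_basis (R : realType) (n r m : nat) (a : 'M[R]_(n, m))
    (b : 'M[R]_(n, r)) : Prop :=
  row_free a^T /\ (a^T :=: b^T)%MS.

Definition linear_reduction (R : realType) (p q m : nat)
    (a : 'M[R]_(p + (q + dim_off q), m)) (c : 'cV[R]_(p + (q + dim_off q)))
    (z : p.-tuple R * q.-tuple bool) : m.-tuple R :=
  [tuple (a^T *m (tstat z - c)) i 0 | i < m].

(* Main.v *)
(* Given Y = y, the joint density of (X, H) splits as
     a (x, h) * exp (ell y + f_y^T b^T t (x, h)),
   with ell collecting the quadratic term in f_y of the normal density and the
   normalizing constant of the Ising model.  By Bayes' rule the posterior of Y
   given (x, h) has density proportional to exp (ell y + f_y^T eta) with respect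
   to the law of Y, where eta = b^T t (x, h); it depends on (x, h) only through
   alpha^T t (x, h), which gives sufficiency.

   For minimality, let S' be another sufficient reduction.  The posterior is
   then a function of S' (X, H), hence so are the log-ratios of the posterior
   probabilities of the grid cells around two values f_y1 and f_y0.  As the grid
   is refined these log-ratios, compared with those at a fixed reference point,
   converge to (f_y1 - f_y0)^T (eta - eta_0), so (f_y1 - f_y0)^T eta is a
   measurable function of S' (X, H).  The linear forms of eta having this
   property make up a vector space, and since f_Y is centered and satisfies no
   linear relation the contrasts f_y1 - f_y0 span everything; thus eta, and with
   it alpha^T t (X, H), is a function of S' (X, H). *)
Require Import Defs.
From HB Require Import structures.
From mathcomp Require Import all_boot all_order all_algebra.
From mathcomp Require Import all_classical all_reals all_analysis.
From mathcomp Require Import measurable_realfun ring lra.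
Import Order.TTheory GRing.Theory Num.Theory.
Import numFieldNormedType.Exports.
Local Open Scope classical_set_scope.
Local Open Scope ring_scope.
Set Implicit Arguments.
Unset Strict Implicit.
Unset Printing Implicit Defensive.

(** * Integration against an image measure given by a density *)

Section transfer.
Local Open Scope ereal_scope.
Import HBNNSimple.

(** The assumption on [nu] says that the image under [U] of [nu] restricted to [E] has density [g]
    with respect to [mu]. This settles indicators; simple functions follow by linearity, and [phi]
    by monotone convergence along [nnsfun_approx]. *)
Lemma ge0_integral_transfer d d' (T : measurableType d)
    (T' : measurableType d') (R : realType) (nu : {measure set T -> \bar R})
    (mu : {measure set T' -> \bar R}) (U : T -> T') (E : set T)
    (g : T' -> R) (phi : T' -> \bar R) :
  measurable_fun [set: T] U -> measurable E ->
  measurable_fun [set: T'] g -> (forall x, 0 <= g x)%R ->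
  (forall C, measurable C -> nu (E `&` U @^-1` C) = \int[mu]_(x in C) (g x)%:E) ->
  measurable_fun [set: T'] phi -> (forall x, 0 <= phi x) ->
  \int[nu]_(w in E) phi (U w) = \int[mu]_x (phi x * (g x)%:E).
Proof.
move=> mU mE mg g0 nuE mphi phi0.
have mEg : measurable_fun [set: T'] (EFin \o g) by exact/measurable_EFinP.
pose h := nnsfun_approx measurableT mphi.
have hcvg x : (EFin \o h n) x @[n --> \oo] --> phi x.
  by apply: cvg_nnsfun_approx => // y _; exact: phi0.
have ndh x : {homo (fun n => (h n x)%:E) : a b / (a <= b)%N >-> a <= b}.
  by move=> a b ab; rewrite lee_fin; exact/lefP/nd_nnsfun_approx.
have mhU n : measurable_fun E (fun w => (h n (U w))%:E).
  by apply/measurable_EFinP/measurable_funTS; exact: measurableT_comp.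
transitivity (limn (fun n => \int[nu]_(w in E) (h n (U w))%:E)).
  rewrite -monotone_convergence//.
  - by apply: eq_integral => x _; apply/esym/cvg_lim => //; exact: hcvg.
  - by move=> n x _; rewrite lee_fin.
transitivity (limn (fun n => \int[mu]_x ((h n x)%:E * (g x)%:E))); last first.
  rewrite -monotone_convergence//.
  - apply: eq_integral => x _; apply/cvg_lim => //.
    by apply: cvgeZr => //; exact: hcvg.
  - by move=> n; apply: emeasurable_funM => //; exact/measurable_EFinP.
  - by move=> n x _; rewrite mule_ge0// lee_fin.
  - by move=> x _ a b ab; rewrite lee_wpmul2r// ?lee_fin//; exact/lefP/nd_nnsfun_approx.
congr (limn _); apply/funext => n.
have mhr r : measurable (h n @^-1` [set r]) by exact: measurable_sfunP.
have mUr r : measurable (U @^-1` (h n @^-1` [set r])).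
  by rewrite -[X in measurable X]setTI; exact: mU.
transitivity (\sum_(r \in range (h n)) r%:E * \int[mu]_(x in h n @^-1` [set r]) (g x)%:E).
  under eq_integral do rewrite fimfunE -fsumEFin//.
  rewrite ge0_integral_fsum//; last 2 first.
  - move=> r; apply/measurable_EFinP/measurable_funTS.
    by apply: (measurableT_comp (f := fun x => r * \1_(h n @^-1` [set r]) x)%R) => //;
      exact: measurable_funM.
  - by move=> r x _; rewrite nnfun_muleindic_ge0.
  apply: eq_fsbigr => r; rewrite inE => -[t _ rE].
  have r0 : (0 <= r)%R by rewrite -rE.
  under eq_integral do rewrite EFinM.
  rewrite ge0_integralZl//; last first.
  - apply/measurable_EFinP/measurable_funTS.
    exact: (measurableT_comp (measurable_indic (mhr r)) mU).
  congr (_ * _).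
  have -> : (fun w => (\1_(h n @^-1` [set r]) (U w))%:E) =
     (fun w => (\1_(U @^-1` (h n @^-1` [set r])) w)%:E :> \bar R).
    by apply/funext => w; rewrite !indicE.
  by rewrite integral_indic// -nuE// setIC.
transitivity (\int[mu]_x (\sum_(y \in range (h n))
    (y * \1_(h n @^-1` [set y]) x)%:E * (g x)%:E)); last first.
  apply: eq_integral => x _.
  rewrite -ge0_mule_fsuml => [|y]; last exact: nnfun_muleindic_ge0.
  by rewrite fsumEFin // -(fimfunE _ x).
rewrite ge0_integral_fsum//; last 2 first.
  - move=> y; apply: emeasurable_funM => //.
    by apply/measurable_EFinP; exact: measurable_funM.
  - by move=> m x _; rewrite mule_ge0 ?lee_fin ?g0// -lee_fin nnfun_muleindic_ge0.
apply: eq_fsbigr => r; rewrite inE => -[t _ rE].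
have r0 : (0 <= r)%R by rewrite -rE.
under [RHS]eq_integral do rewrite EFinM -muleA.
rewrite ge0_integralZl//; last 2 first.
- apply: emeasurable_funM; last by [].
  exact/measurable_EFinP.
- by move=> x _; rewrite mule_ge0 ?lee_fin.
congr (_ * _); rewrite integral_mkcond; apply: eq_integral => x _.
by rewrite muleC epatch_indic.
Qed.

End transfer.

(** * Bayes' rule for kernels given by densities *)

Section density_kernel.
Local Open Scope ereal_scope.
Context d d' (T : measurableType d) (T' : measurableType d') (R : realType).
Context (nu : {sigma_finite_measure set T' -> \bar R}) (G : T * T' -> R).

(** The density is given through its logarithm, which makes it positive everywhere: at each point
    the kernel charges every set that [nu] charges. Its total mass may be infinite. *)
Definition density_kernel (mG : measurable_fun [set: T * T'] G) (x : T)
    (B : set T') : \bar R :=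
  \int[nu]_(y in B) (expR (G (x, y)))%:E.

Hypothesis mG : measurable_fun [set: T * T'] G.

Lemma measurable_density x :
  measurable_fun [set: T'] (fun y => (expR (G (x, y)))%:E).
Proof.
apply/measurable_EFinP; apply: measurableT_comp => //.
exact: measurableT_comp.
Qed.

Let density_kernel0 x : density_kernel mG x set0 = 0.
Proof. by rewrite /density_kernel integral_set0. Qed.

Let density_kernel_ge0 x B : 0 <= density_kernel mG x B.
Proof. by apply: integral_ge0 => y _; rewrite lee_fin expR_ge0. Qed.

Let density_kernel_sigma_additive x :
  semi_sigma_additive (density_kernel mG x).
Proof.
move=> F mF tF mUF; rewrite /density_kernel ge0_integral_bigcup//.
  by apply: is_cvg_ereal_nneg_natsum_cond => n _ _; exact: density_kernel_ge0.
exact/measurable_funTS/measurable_density.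
Qed.

HB.instance Definition _ x := isMeasure.Build _ _ _ (density_kernel mG x)
  (density_kernel0 x) (density_kernel_ge0 x)
  (@density_kernel_sigma_additive x).

Definition mdensity_kernel : T -> {measure set T' -> \bar R} :=
  density_kernel mG.

Let measurable_density_kernel B : measurable B ->
  measurable_fun [set: T] (mdensity_kernel ^~ B).
Proof.
move=> mB.
have mI : measurable_fun [set: T * T']
    (fun z => (expR (G z) * \1_B z.2)%:E).
  apply/measurable_EFinP; apply: measurable_funM.
    exact: measurableT_comp.
  exact: (measurableT_comp (measurable_indic mB) measurable_snd).
have I0 z : 0 <= (expR (G z) * \1_B z.2)%:E :> \bar R.
  by rewrite lee_fin mulr_ge0// expR_ge0.
have := @measurable_fun_fubini_tonelli_F _ _ _ _ _ nu _ mI I0.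
congr (measurable_fun _ _); apply/funext => x.
rewrite /fubini_F /mdensity_kernel /density_kernel /= [RHS]integral_mkcond.
by apply: eq_integral => y _; rewrite epatch_indic EFinM.
Qed.

HB.instance Definition _ := isKernel.Build _ _ _ _ R mdensity_kernel
  measurable_density_kernel.

End density_kernel.

(** [knormalize] falls back on [Q] when the total mass is null or infinite; the two hypotheses
    exclude these cases. *)
Lemma knormalizeE d d' (T : measurableType d) (T' : measurableType d')
    (R : realType) (k : R.-ker T ~> T') (Q : probability T' R) x B :
  (k x [set: T'] != 0 -> k x [set: T'] < +oo ->
  knormalize k Q x B = k x B * (fine (k x [set: T']))^-1%:E)%E.
Proof.
move=> k0 koo; rewrite /knormalize/= /mnormalize ifF//.
by apply/negbTE; rewrite negb_or k0/= lt_eqF.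
Qed.

Section bayes.
Local Open Scope ereal_scope.
Context d d' dY (T : measurableType d) (T' : measurableType d')
  (TY : measurableType dY) (R : realType).
Context (P : probability T R) (mu : {measure set T' -> \bar R})
  (nu : probability TY R) (U : T -> T') (Y : T -> TY) (E : set T)
  (a : T' -> R) (G : T' * TY -> R).
Hypotheses (mU : measurable_fun [set: T] U) (mE : measurable E)
  (mY : measurable_fun [set: T] Y)
  (ma : measurable_fun [set: T'] a) (a_gt0 : forall x, (0 < a x)%R)
  (mG : measurable_fun [set: T' * TY] G).
Hypothesis joint : forall D B, measurable D -> measurable B ->
  P (E `&` U @^-1` D `&` Y @^-1` B) =
  \int[mu]_(x in D) ((a x)%:E * mdensity_kernel nu mG x B).

(** [N] is the normalizing constant of the posterior, and [g] is the density with respect to [mu] of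
    the image under [U] of [P] restricted to [E]. *)
Let N x := mdensity_kernel nu mG x [set: TY].
Let g x := (a x)%:E * N x.

Let mk B : measurable B -> measurable_fun [set: T'] (mdensity_kernel nu mG ^~ B).
Proof. by move=> mB; exact: measurable_kernel. Qed.

Let mg : measurable_fun [set: T'] g.
Proof. by apply: emeasurable_funM; [exact/measurable_EFinP|exact: mk]. Qed.

Let g0 x : 0 <= g x.
Proof. by rewrite mule_ge0// lee_fin ltW. Qed.

Let PUE C : measurable C -> P (E `&` U @^-1` C) = \int[mu]_(x in C) g x.
Proof.
by move=> mC; rewrite -joint// preimage_setT setIT.
Qed.

Let ig : mu.-integrable [set: T'] g.
Proof.
apply/integrableP; split => //.
under eq_integral do rewrite gee0_abs//.
rewrite -PUE// (le_lt_trans (probability_le1 _ _)) ?ltry//.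
by apply: measurableI => //; rewrite -[X in measurable X]setTI; exact: mU.
Qed.

Let gfin : {ae mu, forall x, g x \is a fin_num}.
Proof.
by apply: filterS (integrable_ae measurableT ig) => x; exact.
Qed.

Let mNoo : measurable (N @^-1` [set +oo]).
Proof. by rewrite -[X in measurable X]setTI; exact: mk. Qed.

Let Noo : mu (N @^-1` [set +oo]) = 0.
Proof.
have [A [mA A0 sub]] := gfin.
apply: (subset_measure0 _ _ _ A0) => // x Nx; apply: sub => /=.
by rewrite /g Nx gt0_muley ?lte_fin.
Qed.

(** The integral of [g] is a probability, so [g] is finite [mu]-almost everywhere; as [a] is
    positive, [N] is finite there too. This passes to [P] because the image of [P] on [E] has a
    density with respect to [mu]. *)
Lemma total_density_ltoo : {ae P, forall w, E w -> N (U w) < +oo}.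
Proof.
exists (E `&` U @^-1` (N @^-1` [set +oo])); split.
- by apply: measurableI => //; rewrite -[X in measurable X]setTI; exact: mU.
- by rewrite PUE// null_set_integral//; exact: measurable_funTS.
- move=> w /= /not_implyP[Ew]; rewrite ltey => /negP/negbNE/eqP; by split.
Qed.

(** The posterior mass of [B] is the kernel mass divided by [N], while [U] has density [a] times [N]
    on [E]: the factor [N] cancels and the joint density remains. *)
Lemma bayes D B : measurable D -> measurable B ->
  P (E `&` U @^-1` D `&` Y @^-1` B) =
  \int[P]_(w in E `&` U @^-1` D) knormalize (mdensity_kernel nu mG) nu (U w) B.
Proof.
move=> mD mB; set K := fun x => knormalize (mdensity_kernel nu mG) nu x B.
have K0 x : 0 <= K x by [].
have mK : measurable_fun [set: T'] K by exact: measurable_kernel.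
rewrite joint// integral_mkcondr.
transitivity (\int[P]_(w in E) (K \_ D) (U w)); last first.
  by apply: eq_integral => w _; rewrite !patchE (_ : (w \in _) = (U w \in D))//;
    apply/idP/idP; rewrite !inE.
(* The transfer of integrals asks for a real-valued density; [g] is finite [mu]-almost everywhere,
   so [fine \o g] has the same integrals. *)
rewrite (ge0_integral_transfer (mu := mu) (g := fine \o g))//; last 5 first.
- by apply: measurableT_comp.
- by move=> x; apply: fine_ge0.
- move=> C mC; apply: (eq_trans (PUE mC)); apply: ge0_ae_eq_integral => //.
  + exact: measurable_funTS.
  + by apply/measurable_EFinP/measurable_funTS; exact: measurableT_comp.
  + by move=> x _; rewrite lee_fin; apply: fine_ge0.
  + by apply: filterS gfin => x gx _ /=; rewrite fineK.
- by apply: (measurable_restrictT _ mD).1; exact: measurable_funTS.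
- by move=> x; rewrite patchE; case: ifP.
transitivity (\int[mu]_(x in D) (K x * (fine (g x))%:E)); last first.
  rewrite integral_mkcond; apply: eq_integral => x _.
  by rewrite !patchE; case: ifP => //; rewrite mul0e.
apply: ge0_ae_eq_integral => //.
- apply: measurable_funTS; apply: emeasurable_funM; last exact: mk.
  exact/measurable_EFinP.
- apply: measurable_funTS; apply: emeasurable_funM => //.
  by apply/measurable_EFinP; exact: measurableT_comp.
- by move=> x _; apply: mule_ge0 => //; rewrite lee_fin ltW.
- by move=> x _; apply: mule_ge0 => //; rewrite lee_fin; exact: fine_ge0.
apply: filterS gfin => x gx _; rewrite fineK//.
have Noox : N x < +oo.
  rewrite ltey; apply/eqP => Noox.
  by move: gx; rewrite /g Noox gt0_muley// lte_fin.
(* Where [N x] is zero, [knormalize] takes its default value, but both integrands vanish. *)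
have [N0|N0] := eqVneq (N x) 0.
  rewrite /g N0 !mule0; suff -> : mdensity_kernel nu mG x B = 0 by rewrite mule0.
  exact: (subset_measure0 _ _ _ N0).
rewrite /K knormalizeE// /g muleCA -muleA; congr (_ * _).
have Nfin : N x \is a fin_num by rewrite ge0_fin_numE.
by rewrite -/(N x) -{2}(fineK Nfin) -EFinM mulVf ?mule1// fine_eq0.
Qed.

End bayes.

(** * Factorization of the model density *)

Section dot.
Context (R : realType) (n : nat).
Implicit Types u v : 'cV[R]_n.

Definition dot u v : R := (u^T *m v) 0 0.

Lemma dotE u v : dot u v = \sum_i u i 0 * v i 0.
Proof. by rewrite /dot mxE; apply: eq_bigr => i _; rewrite mxE. Qed.

Lemma dotC u v : dot u v = dot v u.
Proof. by rewrite !dotE; apply: eq_bigr => i _; rewrite mulrC. Qed.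

Lemma dotDr u v w : dot u (v + w) = dot u v + dot u w.
Proof. by rewrite /dot mulmxDr mxE. Qed.

Lemma dotNr u v : dot u (- v) = - dot u v.
Proof. by rewrite /dot mulmxN mxE. Qed.

Lemma dotBr u v w : dot u (v - w) = dot u v - dot u w.
Proof. by rewrite dotDr dotNr. Qed.

Lemma dotBl u v w : dot (v - w) u = dot v u - dot w u.
Proof. by rewrite !(dotC _ u) dotBr. Qed.

End dot.

Lemma dot_mulmx (R : realType) n k (M : 'M[R]_(n, k)) (u : 'cV[R]_n)
  (v : 'cV[R]_k) : dot u (M *m v) = dot (M^T *m u) v.
Proof. by rewrite /dot trmx_mul trmxK mulmxA. Qed.

(** * Half-vectorization of the outer square of a binary vector *)

Section vech_binary.
Context (R : realType) (q : nat).

Lemma vech_seq_uniq : uniq (vech_seq q).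
Proof.
apply: allpairs_uniq_dep => [|j _|]; first exact: enum_uniq.
  by rewrite filter_uniq ?enum_uniq.
by move=> [i j] [i' j'] _ _ /= [-> ->].
Qed.

Lemma mem_off_seq (i j : 'I_q) : ((i, j) \in off_seq q) = (j < i)%N.
Proof.
apply/allpairsPdep/idP => [[j' [i' [_]]]|ji].
  by rewrite mem_filter => /andP[ji _] [-> ->].
by exists j, i; split; rewrite ?mem_enum// mem_filter ji mem_enum.
Qed.

Lemma mem_vech_seq (i j : 'I_q) : ((i, j) \in vech_seq q) = (j <= i)%N.
Proof.
apply/allpairsPdep/idP => [[j' [i' [_]]]|ji].
  by rewrite mem_filter => /andP[ji _] [-> ->].
by exists j, i; split; rewrite ?mem_enum// mem_filter ji mem_enum.
Qed.

Lemma off_seq_uniq : uniq (off_seq q).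
Proof.
apply: allpairs_uniq_dep => [|j _|]; first exact: enum_uniq.
  by rewrite filter_uniq ?enum_uniq.
by move=> [i j] [i' j'] _ _ /= [-> ->].
Qed.

Lemma tnth_vech_pairs_inj : injective (tnth (vech_pairs q)).
Proof. by apply/tuple_uniqP; exact: vech_seq_uniq. Qed.

Lemma tnth_off_pairs_inj : injective (tnth (off_pairs q)).
Proof. by apply/tuple_uniqP; exact: off_seq_uniq. Qed.

(** A binary entry equals its square, so the diagonal of the outer square is [h] itself. The
    transposes of [Lmx] and [Jmx] put diagonal and off-diagonal entries back in place, and each
    position of [vech] is of exactly one kind. *)
Lemma vech_binary (h : q.-tuple bool) (v := vech (colB R h *m (colB R h)^T)) :
  v = (Lmx R q)^T *m colB R h + (Jmx R q)^T *m (Jmx R q *m v).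
Proof.
apply/colP => k; rewrite [in RHS]mxE.
case ek : (tnth (vech_pairs q) k) => [i j].
have : (i, j) \in vech_seq q by rewrite -ek mem_tnth.
rewrite mem_vech_seq => ji.
have vE k' : v k' 0 = (tnth h (tnth (vech_pairs q) k').1)%:R *
                      (tnth h (tnth (vech_pairs q) k').2)%:R.
  by rewrite !mxE big_ord1 !mxE.
have LE : ((Lmx R q)^T *m colB R h) k 0 = (i == j)%:R * (tnth h i)%:R.
  rewrite mxE (bigD1 i)//= !mxE ek xpair_eqE eqxx/= eq_sym.
  rewrite big1 ?addr0// => i' i'i.
  by rewrite !mxE ek xpair_eqE (eq_sym i) (negbTE i'i) mul0r.
have JE : ((Jmx R q)^T *m (Jmx R q *m v)) k 0 = (j < i)%N%:R * v k 0.
  rewrite mxE; case: ltnP => /= ij.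
    have : (i, j) \in off_pairs q by rewrite mem_off_seq.
    case/tnthP => l el.
    rewrite (bigD1 l)//= [X in _ + X]big1 ?addr0 => [|l' l'l]; last first.
      rewrite !mxE ek el (inj_eq tnth_off_pairs_inj).
      by rewrite eq_sym (negbTE l'l) mul0r.
    rewrite mul1r mxE mxE ek el eqxx mul1r mxE.
    rewrite (bigD1 k)//= big1 ?addr0 => [|k' k'k].
      by rewrite mxE ek el eqxx mul1r.
    rewrite mxE -el -ek (inj_eq tnth_vech_pairs_inj).
    by rewrite (negbTE k'k) mul0r.
  rewrite mul0r big1// => l _; rewrite !mxE ek.
  case: eqP => [el|]; last by rewrite mul0r.
  have : (i, j) \in off_seq q by rewrite el mem_tnth.
  by rewrite mem_off_seq ltnNge ij.
rewrite LE JE vE ek/=; have [->|ij] := eqVneq i j.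
  by rewrite ltnn mul0r addr0 mul1r; case: (tnth h j); rewrite ?mulr1 ?mulr0.
by rewrite ltn_neqAle (inj_eq val_inj) eq_sym ij ji mul0r add0r mul1r.
Qed.

End vech_binary.

Section model_density.
Context (R : realType) (p q r : nat) (Delta : 'M[R]_p) (A : 'M[R]_(p, r))
  (beta : 'M[R]_(p, q)) (mu_X : 'cV[R]_p) (mu_H : 'cV[R]_q)
  (tau0 : 'cV[R]_(dim_vech q)) (tau : 'M[R]_(dim_vech q, r)).

(* Logarithms of the factors of the joint density depending on the response
   only and on the predictors only; see [model_density_factor]. *)
Definition log_resp (u : 'cV[R]_r) : R :=
  - ln (\sum_(g : q.-tuple bool) ising_weight (tau0 + tau *m u) g)
  - dot (A *m u) (invmx Delta *m (mu_X - beta *m mu_H))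
  - dot (A *m u) (invmx Delta *m (A *m u)) / 2.

Definition log_pred (h : q.-tuple bool) (x : p.-tuple R) : R :=
  let w := colR x - mu_X - beta *m (colB R h - mu_H) in
  dot (vech (colB R h *m (colB R h)^T)) tau0
  - dot w (invmx Delta *m w) / 2.

(** Expand the quadratic form at [w - A *m u], where [w] is the residual without the response term.
    The square of [w] involves the predictors only, the square of [A *m u] the response only. The
    cross term and the Ising exponent are linear in [u] and yield the transpose of [bmx] applied to
    [tstat]; the constant part of [w] leaves a term that goes into [log_resp]. *)
Lemma model_density_factor (u : 'cV[R]_r) (h : q.-tuple bool)
    (x : p.-tuple R) : Delta^T = Delta ->
  mvnormal_pdf (mu_X + A *m u + beta *m (colB R h - mu_H)) Delta (colR x)
    * ising_pmf (tau0 + tau *m u) h =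
  (Num.sqrt ((pi *+ 2) ^+ p * \det Delta))^-1 * expR (log_pred h x) *
  expR (log_resp u + dot u ((bmx Delta A beta tau)^T *m tstat (x, h))).
Proof.
move=> Dsym.
have Isym : (invmx Delta)^T = invmx Delta by rewrite trmx_inv Dsym.
rewrite /mvnormal_pdf /ising_pmf -!mulrA; congr (_ * _).
have S0 : 0 < \sum_(g : q.-tuple bool) ising_weight (tau0 + tau *m u) g.
  rewrite (bigD1 [tuple false | i < q])//= ltr_wpDr ?expR_gt0//.
  by apply: sumr_ge0 => g _; exact: expR_ge0.
set S := \sum_g _ in S0 *.
have -> : S^-1 = expR (- ln S) by rewrite expRN lnK// posrE.
rewrite /ising_weight -!expRD; congr expR.
rewrite /log_resp /log_pred -/S.
set lnS := ln _; set v := vech _; set D := invmx Delta.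
set w := colR x - mu_X - beta *m (colB R h - mu_H).
have -> : colR x - (mu_X + A *m u + beta *m (colB R h - mu_H)) = w - A *m u.
  by rewrite /w !opprD !addrA addrAC.
have Dsw (s t : 'cV[R]_p) : dot s (D *m t) = dot t (D *m s).
  by rewrite dot_mulmx Isym dotC.
have -> : ((w - A *m u)^T *m D *m (w - A *m u)) 0 0 =
   dot w (D *m w) - dot (A *m u) (D *m w) *+ 2 + dot (A *m u) (D *m (A *m u)).
  rewrite -mulmxA -/(dot _ _) mulmxBr dotBl !dotBr (Dsw w (A *m u)) mulr2n.
  by rewrite !opprD !opprK !addrA.
rewrite -/(dot _ _) dotDr.
(* The [Lmx] and [Jmx] blocks of [bmx] recombine into the full [vech] by [vech_binary]; the term in
   [beta] matches the effect of [h] on the normal mean. *)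
have -> : dot u ((bmx Delta A beta tau)^T *m tstat (x, h)) =
    dot (A *m u) (D *m colR x) - dot (A *m u) (D *m (beta *m colB R h)) +
    dot v (tau *m u).
  rewrite /bmx /tstat /= !tr_col_mx !mul_row_col -/v.
  rewrite linearB/= !trmx_mul Isym trmxK mulmxBl !dotDr dotNr -/D.
  rewrite -!mulmxA (dot_mulmx A^T) trmxK (dot_mulmx A^T) trmxK -!addrA.
  congr (_ + _); rewrite addrCA; congr (_ + _).
  rewrite -dotDr -mulmxDr -vech_binary (dot_mulmx tau^T) trmxK.
  exact: dotC.
have -> : dot (A *m u) (D *m w) = dot (A *m u) (D *m colR x)
   - dot (A *m u) (D *m (beta *m colB R h))
   - dot (A *m u) (D *m (mu_X - beta *m mu_H)).
  rewrite -!dotBr -!mulmxBr /w; congr (dot _ (_ *m _)).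
  rewrite mulmxBr; move: (beta *m _) (beta *m _) => s t.
  by apply/colP => i; rewrite !mxE; ring.
move: (dot _ _) (dot _ _) (dot _ _) (dot _ _) (dot _ _) (dot _ _) (dot _ _) => *.
lra.
Qed.

End model_density.

(** * Joint law of the model *)

Section measurable_col.
Context d (T : measurableType d) (R : realType).

(** Measurability of vector-valued maps is taken coordinatewise, in the form of the assumption on
    [f]. *)
Definition measurable_col n (V : T -> 'cV[R]_n) : Prop :=
  forall i, measurable_fun [set: T] (fun x => V x i 0).

Lemma measurable_dot n (V W : T -> 'cV[R]_n) :
  measurable_col V -> measurable_col W ->
  measurable_fun [set: T] (fun x => dot (V x) (W x)).
Proof.
move=> mV mW; under eq_fun do rewrite dotE.
by apply: measurable_sum => i; exact: measurable_funM.
Qed.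

Lemma measurable_col_cst n (c : 'cV[R]_n) : measurable_col (fun=> c).
Proof. by move=> i; exact: measurable_cst. Qed.

Lemma measurable_col_mulmx n k (M : 'M[R]_(n, k)) (V : T -> 'cV[R]_k) :
  measurable_col V -> measurable_col (fun x => M *m V x).
Proof.
move=> mV i; under eq_fun do rewrite mxE.
by apply: measurable_sum => j; exact: measurable_funM.
Qed.

Lemma measurable_colD n (V W : T -> 'cV[R]_n) :
  measurable_col V -> measurable_col W -> measurable_col (fun x => V x + W x).
Proof.
by move=> mV mW i; under eq_fun do rewrite mxE; exact: measurable_funD.
Qed.

Lemma measurable_colB n (V W : T -> 'cV[R]_n) :
  measurable_col V -> measurable_col W -> measurable_col (fun x => V x - W x).
Proof.
move=> mV mW i; under eq_fun do rewrite mxE [X in _ + X]mxE.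
exact: measurable_funB.
Qed.

Lemma measurable_col_mx n k (V : T -> 'cV[R]_n) (W : T -> 'cV[R]_k) :
  measurable_col V -> measurable_col W ->
  measurable_col (fun x => col_mx (V x) (W x)).
Proof.
move=> mV mW i; under eq_fun do rewrite mxE.
case: (fintype.split i) => j; [exact: mV|exact: mW].
Qed.

Lemma measurable_col_comp d' (T' : measurableType d') n (V : T -> 'cV[R]_n)
    (U : T' -> T) : measurable_col V -> measurable_fun [set: T'] U ->
  forall i, measurable_fun [set: T'] (fun x => V (U x) i 0).
Proof. by move=> mV mU i; exact: (measurableT_comp (mV i) mU). Qed.

End measurable_col.

Lemma measurable_colR (R : realType) n :
  measurable_col (fun x : n.-tuple R => colR x).
Proof.
by move=> i; under eq_fun do rewrite mxE; exact: measurable_tnth.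
Qed.

Lemma measurable_colB_tuple (R : realType) n :
  measurable_col (fun h : n.-tuple bool => colB R h).
Proof.
move=> i; under eq_fun do rewrite mxE.
apply: (measurableT_comp (f := fun b : bool => b%:R : R)) => //.
exact: measurable_tnth.
Qed.

Lemma measurable_vech_colB (R : realType) q :
  measurable_col (fun h : q.-tuple bool => vech (colB R h *m (colB R h)^T)).
Proof.
move=> k; under eq_fun do rewrite !mxE big_ord1 [X in _ * X]mxE.
by apply: measurable_funM; exact: measurable_colB_tuple.
Qed.

Lemma measurable_tstat (R : realType) p q :
  measurable_col (fun z : p.-tuple R * q.-tuple bool => tstat z).
Proof.
apply: measurable_col_mx.
  exact: measurable_col_comp (@measurable_colR R p) measurable_fst.
apply: measurable_col_mx.
  exact: measurable_col_comp (@measurable_colB_tuple R q) measurable_snd.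
apply: measurable_col_mulmx.
exact: measurable_col_comp (@measurable_vech_colB R q) measurable_snd.
Qed.

Lemma measurable_tuple_bool1 q (h : q.-tuple bool) : measurable [set h].
Proof.
rewrite (_ : [set h] =
    \bigcap_(i in [set: 'I_q]) ((@tnth q bool ^~ i) @^-1` [set tnth h i])).
  apply: fin_bigcap_measurable => // i _.
  by rewrite -[X in measurable X]setTI; exact: measurable_tnth.
apply/seteqP; split=> [g -> //|g gh] /=.
by apply: eq_from_tnth => i; exact: gh.
Qed.

(** Tonelli's theorem for [F] extended by zero outside the rectangle [D] times [B]. *)
Lemma fubini_tonelli_setX d d' (T : measurableType d) (T' : measurableType d')
    (R : realType) (mu : {sigma_finite_measure set T -> \bar R})
    (nu : {sigma_finite_measure set T' -> \bar R}) (F : T * T' -> \bar R) D B :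
  measurable_fun [set: T * T'] F -> (forall z, 0 <= F z)%E ->
  measurable D -> measurable B ->
  (\int[mu]_(x in D) \int[nu]_(y in B) F (x, y) =
   \int[nu]_(y in B) \int[mu]_(x in D) F (x, y))%E.
Proof.
move=> mF F0 mD mB.
have mDB : measurable (D `*` B) by exact: measurableX.
have F_DB x y : (F \_ (D `*` B)) (x, y) =
    if (x \in D) && (y \in B) then F (x, y) else 0%E.
  by rewrite patchE in_setX.
have := @fubini_tonelli _ _ _ _ _ mu nu (F \_ (D `*` B)).
move=> /(_ ((measurable_restrictT _ mDB).1 (measurable_funTS mF))).
move=> /(_ (fun z => erestrict_ge0 (fun z _ => F0 z) z)) FDB.
rewrite integral_mkcond [RHS]integral_mkcond; move: FDB; congr (_ = _).
- apply: eq_integral => x _; rewrite patchE; case: ifPn => xD.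
    rewrite [RHS]integral_mkcond; apply: eq_integral => y _.
    by rewrite F_DB xD patchE.
  by apply: integral0_eq => y _; rewrite F_DB (negbTE xD).
- apply: eq_integral => y _; rewrite patchE; case: ifPn => yB.
    rewrite [RHS]integral_mkcond; apply: eq_integral => x _.
    by rewrite F_DB yB andbT patchE.
  by apply: integral0_eq => x _; rewrite F_DB (negbTE yB) andbF.
Qed.

(** * Splitting along a map with finitely many values *)

Section finite_partition.
Local Open Scope ereal_scope.
Context d (T : measurableType d) (R : realType)
  (mu : {measure set T -> \bar R}) (I : finType) (H : T -> I).
Hypothesis mH : forall h, measurable (H @^-1` [set h]).

(** This allows arguing on each event [H = h] separately, where the predictors vary through their
    continuous part only. *)
Lemma ge0_integral_finite_partition (E : set T) (phi : T -> \bar R) :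
  measurable E -> measurable_fun [set: T] phi -> (forall x, 0 <= phi x) ->
  \int[mu]_(x in E) phi x =
  \sum_h \int[mu]_(x in H @^-1` [set h] `&` E) phi x.
Proof.
move=> mE mphi phi0.
have {1}-> : E = \big[setU/set0]_(h <- index_enum I) (H @^-1` [set h] `&` E).
  rewrite -bigcup_seq; apply/seteqP; split => [x Ex|x [h _ []//]].
  by exists (H x); rewrite //= mem_index_enum.
rewrite ge0_integral_bigsetU//.
- by move=> h; exact: measurableI.
- exact: index_enum_uniq.
- by move=> h h' _ _ [x [[/= <- _] [/= <- _]]].
- exact: measurable_funTS.
Qed.

Lemma measure_finite_partition (E : set T) : measurable E ->
  mu E = \sum_h mu (H @^-1` [set h] `&` E).
Proof.
move=> mE; rewrite -[LHS]mul1e -integral_cst// ge0_integral_finite_partition//.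
apply: eq_bigr => h _; rewrite integral_cst ?mul1e//.
exact: measurableI.
Qed.

End finite_partition.

Section joint_law.
Context (R : realType) (d dY : measure_display)
  (T : measurableType d) (TY : measurableType dY) (P : probability T R)
  (p q r : nat)
  (Y : {RV P >-> TY}) (X : {RV P >-> p.-tuple R}) (H : {RV P >-> q.-tuple bool})
  (f : TY -> 'cV[R]_r)
  (Delta : 'M[R]_p) (A : 'M[R]_(p, r)) (beta : 'M[R]_(p, q))
  (mu_X : 'cV[R]_p) (mu_H : 'cV[R]_q)
  (tau0 : 'cV[R]_(dim_vech q)) (tau : 'M[R]_(dim_vech q, r)).
Hypotheses (f_meas : measurable_col f) (Delta_sym : Delta^T = Delta)
  (X_law : is_cond_distr P X (fun w => (H w, Y w))
    (fun hy => mvnormal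
      (mu_X + A *m f hy.2 + beta *m (colB R hy.1 - mu_H)) Delta))
  (H_law : is_cond_distr P H Y (fun y => ising (tau0 + tau *m f y))).

Let nu := distribution P Y.
Let cst_normal : R := (Num.sqrt ((pi *+ 2) ^+ p * \det Delta))^-1.
Let logY y := log_resp Delta A beta mu_X mu_H tau0 tau (f y).
Let eta z := (bmx Delta A beta tau)^T *m tstat (R := R) (p := p) (q := q) z.

(** The factor of the joint density that is free of the response; the other factor is the
    exponential of [log_joint]. *)
Definition pred_density h x : R :=
  cst_normal * expR (log_pred Delta beta mu_X mu_H tau0 h x).

Definition log_joint (zy : (p.-tuple R * q.-tuple bool) * TY) : R :=
  logY zy.2 + dot (f zy.2) (eta zy.1).

Lemma measurable_log_resp : measurable_fun [set: TY] logY.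
Proof.
have mAf : measurable_col (fun y => A *m f y) by exact: measurable_col_mulmx.
apply: measurable_funB; first apply: measurable_funB.
- apply: measurableT_comp => //; apply: measurableT_comp => //.
  apply: measurable_sum => g; apply: measurableT_comp => //.
  apply: measurable_dot; first exact: measurable_col_cst.
  apply: measurable_colD; first exact: measurable_col_cst.
  exact: measurable_col_mulmx.
- by apply: measurable_dot => //; exact: measurable_col_cst.
- apply: measurable_funM => //; apply: measurable_dot => //.
  exact: measurable_col_mulmx.
Qed.

Lemma measurable_pred_density h : measurable_fun [set: p.-tuple R] (pred_density h).
Proof.
have mw : measurable_col (fun x : p.-tuple R =>
    colR x - mu_X - beta *m (colB R h - mu_H)).
  apply: measurable_colB; last exact: measurable_col_cst.
  by apply: measurable_colB; [exact: measurable_colR|exact: measurable_col_cst].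
apply: measurable_funM => //; apply: measurableT_comp => //.
apply: measurable_funB => //; apply: measurable_funM => //.
by apply: measurable_dot => //; exact: measurable_col_mulmx.
Qed.

Lemma measurable_eta : measurable_col eta.
Proof. by apply: measurable_col_mulmx; exact: measurable_tstat. Qed.

Lemma measurable_log_joint : measurable_fun setT log_joint.
Proof.
apply: measurable_funD; first exact: measurableT_comp measurable_log_resp _.
apply: measurable_dot.
  exact: measurable_col_comp f_meas measurable_snd.
exact: measurable_col_comp measurable_eta measurable_fst.
Qed.

(** Were the constant zero, the normal density would vanish identically, and [X_law] on the whole
    space would give total probability 0. Positivity is thus read off the law of [X] instead of the
    determinant. *)
Lemma cst_normal_gt0 : 0 < cst_normal.
Proof.
rewrite lt_def invr_ge0 sqrtr_ge0 andbT; apply/eqP => C0.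
have [_ /(_ _ measurableT)] := X_law measurableT.
rewrite !preimage_setT setIT probability_setT.
rewrite (eq_integral (cst 0%E)) ?integral0; first by move/eqP; rewrite onee_eq0.
move=> w _; rewrite /mvnormal; apply: integral0_eq => x _.
by rewrite /mvnormal_pdf -/cst_normal C0 mul0r.
Qed.

Lemma pred_density_gt0 h x : 0 < pred_density h x.
Proof. by rewrite mulr_gt0 ?cst_normal_gt0// expR_gt0. Qed.

Lemma measurable_log_joint_at h :
  measurable_fun setT (fun xy : p.-tuple R * TY => log_joint ((xy.1, h), xy.2)).
Proof.
apply: (measurableT_comp (f := log_joint)); first exact: measurable_log_joint.
by apply: measurable_fun_pair => //; exact: measurable_fun_pair.
Qed.

(** [X_law] and then [H_law] turn the probability into an integral over the law of [Y] of a normal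
    mass times an Ising probability. After factorization of the density, Tonelli exchanges the two
    integrals and the factor in [x] leaves the inner one. *)
Lemma model_joint_law h D B : measurable D -> measurable B ->
  (P (H @^-1` [set h] `&` X @^-1` D `&` Y @^-1` B) =
  \int[lebesgue_tuple R p]_(x in D)
    ((pred_density h x)%:E * mdensity_kernel nu (measurable_log_joint_at h) x B))%E.
Proof.
move=> mD mB.
have mh := measurable_tuple_bool1 h.
pose m y := mu_X + A *m f y + beta *m (colB R h - mu_H).
pose N y := mvnormal (m y) Delta D.
have isingE y : ising (tau0 + tau *m f y) [set h] =
    (ising_pmf (tau0 + tau *m f y) h)%:E.
  rewrite /ising (big_pred1 h)// => g.
  by apply/idP/eqP; rewrite inE.
have [mIsing PH] := H_law mh.
have mpmf : measurable_fun [set: TY] (fun y => ising_pmf (tau0 + tau *m f y) h).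
  apply/measurable_EFinP; move: mIsing; congr (measurable_fun _ _).
  by apply/funext => y; rewrite isingE.
have pmf_ge0 y : 0 <= ising_pmf (tau0 + tau *m f y) h.
  rewrite mulr_ge0 ?expR_ge0// invr_ge0; apply: sumr_ge0 => g _.
  exact: expR_ge0.
have [mX PX] := X_law mD.
have mN : measurable_fun [set: TY] N.
  apply: (measurableT_comp (g := fun y : TY => (h, y)) mX).
  by apply: measurable_fun_pair => //; exact: measurable_cst.
have N0 y : (0 <= N y)%E.
  apply: integral_ge0 => x _; rewrite lee_fin; apply: mulr_ge0.
    exact: ltW cst_normal_gt0.
  exact: expR_ge0.
have mYB : measurable (Y @^-1` B).
  by rewrite -[X in measurable X]setTI; exact: measurable_funP.
have mHh : measurable (H @^-1` [set h]).
  by rewrite -[X in measurable X]setTI; exact: measurable_funP.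
transitivity (\int[P]_(w in H @^-1` [set h] `&` Y @^-1` B) N (Y w))%E.
  rewrite -setIA setIC -setIA (setIC (_ @^-1` B)).
  have := PX _ (measurableX mh mB).
  move=> ->; apply: eq_integral => w; rewrite inE /= => -[/= Hw _].
  by rewrite Hw.
rewrite integral_mkcondr.
transitivity (\int[P]_(w in H @^-1` [set h]) (N \_ B) (Y w))%E.
  by apply: eq_integral => w _; rewrite !patchE (_ : (w \in _) = (Y w \in B))//;
    apply/idP/idP; rewrite !inE.
(* By [H_law], the law of [Y] restricted to the event [H = h] has the Ising probability of [h] as
   its density with respect to [nu]. *)
rewrite (ge0_integral_transfer (mu := nu)
  (g := fun y => ising_pmf (tau0 + tau *m f y) h))//; last 3 first.
- move=> C mC; apply: (eq_trans (PH _ mC)).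
  under [RHS]eq_integral do rewrite -isingE.
  apply/esym/ge0_integral_pushforward => //.
  + exact: measurable_funTS.
  + by move=> y _; rewrite isingE lee_fin.
- by apply: (measurable_restrictT _ mB).1; exact: measurable_funTS.
- by move=> y; rewrite patchE; case: ifP.
transitivity (\int[nu]_(y in B)
  (N y * (ising_pmf (tau0 + tau *m f y) h)%:E))%E.
  rewrite [RHS]integral_mkcond; apply: eq_integral => y _.
  by rewrite !patchE; case: ifP => //; rewrite mul0e.
pose F (z : p.-tuple R * TY) :=
  (pred_density h z.1 * expR (log_joint ((z.1, h), z.2)))%:E : \bar R.
have mexp := measurableT_comp (@measurable_expR R) (measurable_log_joint_at h).
have mF : measurable_fun setT F.
  apply/measurable_EFinP; apply: measurable_funM => //.
  exact: measurableT_comp (measurable_pred_density h) measurable_fst.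
have F0 z : (0 <= F z)%E by rewrite lee_fin mulr_ge0 ?expR_ge0// ltW// pred_density_gt0.
transitivity (\int[nu]_(y in B) \int[lebesgue_tuple R p]_(x in D) F (x, y))%E.
  apply: eq_integral => y _; rewrite -ge0_integralZr//.
  - apply: eq_integral => x _; rewrite /F -EFinM; congr (_%:E).
    by rewrite /m model_density_factor.
  - apply/measurable_EFinP/measurable_funTS; apply: measurable_funM => //.
    apply: measurableT_comp => //; apply: measurable_funM => //.
    apply: measurableT_comp => //.
    have mxm : measurable_col (fun x : p.-tuple R => colR x - m y).
      by apply: measurable_colB; [exact: measurable_colR|exact: measurable_col_cst].
    under eq_fun do rewrite -mulmxA -/(dot _ _).
    by apply: measurable_dot => //; exact: measurable_col_mulmx.
  - move=> x _; rewrite lee_fin; apply: mulr_ge0; last exact: expR_ge0.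
    exact: ltW cst_normal_gt0.
  - by rewrite lee_fin.
apply: (eq_trans (esym (@fubini_tonelli_setX _ _ _ _ _
  (lebesgue_tuple R p) nu F D B mF F0 mD mB))).
apply: eq_integral => x _.
rewrite -ge0_integralZl//.
- exact/measurable_funTS/(measurable_density (measurable_log_joint_at h)).
- by rewrite lee_fin ltW// pred_density_gt0.
Qed.

Let Z w := (X w, H w).
Let K := mdensity_kernel nu measurable_log_joint.

Lemma measurable_predictors : measurable_fun [set: T] Z.
Proof. by apply: measurable_fun_pair; exact: measurable_funP. Qed.

Lemma measurable_preimage_H h : measurable (H @^-1` [set h]).
Proof.
rewrite -[X in measurable X]setTI; apply: measurable_funP => //.
exact: measurable_tuple_bool1.
Qed.

(** There is one null set for each of the finitely many values of [H]. *)
Lemma model_total_ltoo : {ae P, forall w, (K (Z w) [set: TY] < +oo)%E}.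
Proof.
have Hh h := @total_density_ltoo _ _ _ T (p.-tuple R) TY R P
  (lebesgue_tuple R p) nu X Y _ (pred_density h) _ (measurable_funP X)
  (measurable_preimage_H h) (measurable_pred_density h) (pred_density_gt0 h)
  (measurable_log_joint_at h) (fun D B => @model_joint_law h D B).
have Hall := @filter_forall _ _ _ _ (ae_filter_ringOfSetsType P) Hh.
by apply: filterS Hall => w /(_ (H w)); exact.
Qed.

(** On the event [H = h] the pair [Z] is a function of [X], so [bayes] applies with this event as
    [E] and with the section of [C] at [h]; the finitely many pieces add up. *)
Lemma model_cond_distr : is_cond_distr P Y Z (fun z => knormalize K nu z).
Proof.
move=> B mB; split; first exact: measurable_kernel.
move=> C mC.
have mZC : measurable (Z @^-1` C).
  by rewrite -[X in measurable X]setTI; exact: measurable_predictors.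
have mYB : measurable (Y @^-1` B).
  by rewrite -[X in measurable X]setTI; exact: measurable_funP.
rewrite (measure_finite_partition _ measurable_preimage_H); last exact: measurableI.
rewrite (ge0_integral_finite_partition _ measurable_preimage_H)//; last first.
  apply: (measurableT_comp (f := knormalize K nu ^~ B)).
    exact: measurable_kernel.
  exact: measurable_predictors.
apply: eq_bigr => h _.
pose Ch := (fun x : p.-tuple R => (x, h)) @^-1` C.
have mCh : measurable Ch.
  rewrite -[X in measurable X]setTI.
  have : measurable_fun setT (fun x : p.-tuple R => (x, h)) by exact: measurable_fun_pair.
  exact.
have HZC : H @^-1` [set h] `&` Z @^-1` C = H @^-1` [set h] `&` X @^-1` Ch.
  by apply/seteqP; split => w [/= Hw]; rewrite /Ch /Z /= Hw.
rewrite HZC (setIC (Y @^-1` B)) setIA HZC.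
apply: (eq_trans (bayes (measurable_funP X) (measurable_preimage_H h)
  (measurable_pred_density h) (pred_density_gt0 h)
  (fun D B => @model_joint_law h D B) mCh mB)).
by apply: eq_integral => w; rewrite inE => -[/= Hw _]; rewrite /Z Hw.
Qed.

End joint_law.

(** * Conditional distributions and sufficiency *)

Section conditional_distributions.
Local Open Scope ereal_scope.
Context d dY dZ (T : measurableType d) (TY : measurableType dY)
  (TZ : measurableType dZ) (R : realType) (P : probability T R)
  (Y : T -> TY) (Z : T -> TZ).
Hypothesis mZ : measurable_fun [set: T] Z.

Lemma eq_knormalize d1 d2 (T1 : measurableType d1) (T2 : measurableType d2)
    (k1 : R.-ker T1 ~> TY) (k2 : R.-ker T2 ~> TY) (Q : probability TY R) x1 x2 :
  (forall B, k1 x1 B = k2 x2 B) ->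
  forall B, knormalize k1 Q x1 B = knormalize k2 Q x2 B.
Proof.
move=> k12 B; rewrite /knormalize/= /mnormalize k12.
by case: ifP => _; rewrite ?k12.
Qed.

(** Both kernels have the same integral over every measurable set under the law of [Z], hence agree
    almost everywhere for that law. The null set depends on [B], so the result is used for countably
    many sets at a time. *)
Lemma cond_distr_unique (K1 K2 : R.-pker TZ ~> TY) (B : set TY) :
  is_cond_distr P Y Z (fun z => K1 z) -> is_cond_distr P Y Z (fun z => K2 z) ->
  measurable B -> {ae P, forall w, K1 (Z w) B = K2 (Z w) B}.
Proof.
move=> K1P K2P mB; have [mK1 {}K1P] := K1P _ mB; have [mK2 {}K2P] := K2P _ mB.
pose mfZ := isMeasurableFun.Build _ _ _ _ _ mZ.
pose Zf : {mfun T >-> TZ} := HB.pack Z mfZ.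
pose PZ := distribution P Zf.
have iK1 : PZ.-integrable [set: TZ] (K1 ^~ B).
  apply/integrableP; split => //.
  under eq_integral do rewrite gee0_abs//.
  rewrite ge0_integral_pushforward// preimage_setT.
  apply: (@le_lt_trans _ _ (\int[P]_(x in [set: T]) (cst 1) x)).
    apply: ge0_le_integral => //.
      exact: (measurableT_comp (f := K1 ^~ B) mK1 mZ).
    by move=> x _ /=; rewrite -(prob_kernel (s := K1) (Z x)) le_measure ?inE.
  rewrite integral_cst// mul1e.
  exact: le_lt_trans (probability_le1 P measurableT) (ltry _).
have [N [mN N0 sub]] : ae_eq PZ [set: TZ] (K1 ^~ B) (K2 ^~ B).
  apply: integral_ae_eq => // C _ mC.
  rewrite !ge0_integral_pushforward//; try exact: measurable_funTS.
  by rewrite /= -K1P// -K2P.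
exists (Z @^-1` N); split => //.
  by rewrite -[X in measurable X]setTI; exact: mZ.
by move=> w /= KZ; apply: sub => /= /(_ Logic.I).
Qed.

(** The kernel built from [G'] agrees pointwise with the one built from [G]. It is a version of the
    conditional distribution given [S \o Z] because preimages under [S] are among the test sets for
    [Z]. *)
Lemma sufficient_density_kernel dS (TS : measurableType dS) (S : TZ -> TS)
    (nu : probability TY R) (G : TZ * TY -> R) (G' : TS * TY -> R)
    (mG : measurable_fun [set: TZ * TY] G)
    (mG' : measurable_fun [set: TS * TY] G') :
  measurable_fun [set: TZ] S -> (forall z y, G (z, y) = G' (S z, y)) ->
  is_cond_distr P Y Z (fun z => knormalize (mdensity_kernel nu mG) nu z) ->
  sufficient_reduction P Y Z S.
Proof.
move=> mS GG' KP; split => //.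
pose K : R.-pker TZ ~> TY := knormalize (mdensity_kernel nu mG) nu.
pose K' : R.-pker TS ~> TY := knormalize (mdensity_kernel nu mG') nu.
have KK' z B : K z B = K' (S z) B.
  apply: eq_knormalize => {}B; apply: eq_integral => y _.
  by rewrite GG'.
exists K, K'; split => //; last by apply: aeW => w B _; exact: KK'.
move=> B mB; split; first exact: measurable_kernel.
move=> C mC; have [_ KPB] := KP _ mB.
have mSC : measurable (S @^-1` C).
  by rewrite -[X in measurable X]setTI; exact: mS.
apply: (eq_trans (KPB _ mSC)).
by apply: eq_integral => w _; exact: KK'.
Qed.

End conditional_distributions.

(** The integral is that of the positive part minus that of the negative part, and the difference is
    finite only if both are. *)
Lemma integrable_fin_num d (T : measurableType d) (R : realType)
    (mu : {measure set T -> \bar R}) (g : T -> R) :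
  measurable_fun [set: T] g -> (\int[mu]_x (g x)%:E)%E \is a fin_num ->
  mu.-integrable [set: T] (EFin \o g).
Proof.
move=> mg; rewrite integralE fin_numB => /andP[gp gn].
apply/integrableP; split; first exact/measurable_EFinP.
have mEg : measurable_fun [set: T] (EFin \o g) by exact/measurable_EFinP.
rewrite (_ : (fun x => _) = abse \o (EFin \o g))// fune_abse.
rewrite ge0_integralD//; last 2 first.
- exact: measurable_funepos.
- exact: measurable_funeneg.
by rewrite lte_add_pinfty// ltey_eq ?gp ?gn.
Qed.

(** * Linear subspaces given by a predicate *)

Section row_subspace.
Context (F : fieldType) (n : nat) (V : 'rV[F]_n -> Prop).
Hypotheses (V0 : V 0) (VD : forall u v, V u -> V v -> V (u + v))
  (VZ : forall a v, V v -> V (a *: v)).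

Lemma row_subspace_sub m (M : 'M[F]_(m, n)) (u : 'rV_n) :
  (forall i, V (row i M)) -> (u <= M)%MS -> V u.
Proof.
move=> VM /submxP[D ->]; rewrite mulmx_sum_row.
by elim/big_rec: _ => [|i v _ Vv]; [exact: V0|exact: VD (VZ _ (VM i)) Vv].
Qed.

(** A matrix of maximal rank with rows in [V] spans [V], since adjoining another vector of [V]
    cannot raise the rank. The columns of its cokernel are annihilated by [V], hence zero, so its
    row space is everything. *)
Lemma row_subspace_full :
  (forall c : 'cV_n, (forall v, V v -> v *m c = 0) -> c = 0) -> forall v, V v.
Proof.
move=> Vfull.
pose rk k := `[< exists M : 'M[F]_n, (forall i, V (row i M)) /\ \rank M = k >].
have rk0 : exists k, rk k.
  exists 0%N; apply/asboolP; exists 0; split => [i|]; last exact: mxrank0.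
  by rewrite row0.
have rkn k : rk k -> (k <= n)%N by move=> /asboolP[M [_ <-]]; exact: rank_leq_row.
case: (ex_maxnP rk0 rkn) => k /asboolP[M [VM <-]] Mmax.
have VsubM v : V v -> (v <= M)%MS.
  move=> Vv; pose N := <<col_mx M v>>%MS.
  have MN : (M <= N)%MS by rewrite genmxE -addsmxE addsmxSl.
  have vN : (v <= N)%MS by rewrite genmxE -addsmxE addsmxSr.
  have /Mmax rkN : rk (\rank N).
    apply/asboolP; exists N; split => // i.
    apply: (@row_subspace_sub _ (col_mx M v)) => [j|].
      rewrite -[j]splitK; case: (fintype.split j) => l /=.
        by rewrite rowKu.
      by rewrite rowKd ord1 row_id.
    by rewrite -(genmxE (col_mx M v)) row_sub.
  apply: (submx_trans vN).
  by rewrite -(geq_leqif (mxrank_leqif_sup MN)).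
move=> u; apply: (row_subspace_sub VM).
suff cM0 : cokermx M = 0 by rewrite submxE cM0 mulmx0.
apply/matrixP => i j.
suff /colP/(_ i) : col j (cokermx M) = 0 by rewrite !mxE.
apply: Vfull => v /VsubM; rewrite submxE colE mulmxA => /eqP ->.
by rewrite mul0mx.
Qed.

End row_subspace.

(** * Exponential tilting on grid cells *)

(** The null fibres are countably many, so their union is negligible. *)
Lemma ae_fiber_gt0 d (T : measurableType d) (R : realType)
    (mu : {measure set T -> \bar R}) (I : countType) (g : T -> I) :
  (forall i, measurable (g @^-1` [set i])) ->
  {ae mu, forall x, (0 < mu (g @^-1` [set g x]))%E}.
Proof.
move=> mg.
pose F n := if @unpickle I n is Some i then
  if mu (g @^-1` [set i]) == 0%E then g @^-1` [set i] else set0 else set0.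
have : mu.-negligible (\bigcup_n F n).
  apply: negligible_bigcup => n; rewrite /F; case: unpickle => [i|]; last first.
    exact: negligible_set0.
  by case: eqP => [i0|_]; [exact/negligibleP|exact: negligible_set0].
apply: negligibleS => x /= /negP; rewrite -leNgt measure_le0 => gx0.
by exists (pickle (g x)) => //; rewrite /F pickleK gx0.
Qed.

(** A zero integral would make the positive function [expR] vanish almost everywhere on [B], forcing
    [B] to be null. *)
Lemma integral_expR_gt0 d (T : measurableType d) (R : realType)
    (mu : {measure set T -> \bar R}) (B : set T) (g : T -> R) :
  measurable B -> measurable_fun [set: T] g -> (0 < mu B)%E ->
  (0 < \int[mu]_(x in B) (expR (g x))%:E)%E.
Proof.
move=> mB mg muB; rewrite lt0e integral_ge0 ?andbT; last first.
  by move=> x _; rewrite lee_fin expR_ge0.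
apply/eqP => I0; have : mu B = 0%E.
  have : ae_eq mu B (fun x => (expR (g x))%:E) (cst 0%E).
    apply/ae_eq_integral_abs => //.
      by apply/measurable_funTS/measurable_EFinP; exact: measurableT_comp.
    by rewrite -[RHS]I0; apply: eq_integral => x _; rewrite gee0_abs// lee_fin expR_ge0.
  move=> [N [mN N0 sub]]; apply: (subset_measure0 _ _ _ N0) => // x Bx.
  by apply: sub => /= /(_ Bx) [] /eqP; rewrite gt_eqF// expR_gt0.
by move=> B0; move: muB; rewrite B0 ltxx.
Qed.

Section grid.
Context d (T : measurableType d) (R : realType) (r : nat) (f : T -> 'cV[R]_r).
Hypothesis mf : measurable_col f.

(** The label of the half-open cube of side 1/(n+1) that contains [f x]; integer labels keep the
    cells countable. *)
Definition grid (n : nat) (x : T) : 'cV[int]_r :=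
  \col_i Num.floor (n.+1%:R * f x i 0).

Lemma measurable_grid n v : measurable (grid n @^-1` [set v]).
Proof.
rewrite (_ : _ @^-1` _ = \bigcap_(i in [set: 'I_r])
    (fun x => n.+1%:R * f x i 0) @^-1` `[(v i 0)%:~R, (v i 0 + 1)%:~R[%classic).
  apply: fin_bigcap_measurable => // i _; rewrite -[X in measurable X]setTI.
  have : measurable_fun [set: T] (fun x => n.+1%:R * f x i 0) by exact: measurable_funM.
  by apply.
apply/seteqP; split => [x /= <- i _|x xv] /=.
  by rewrite in_itv/= mxE floor_itv.
apply/colP => i; rewrite mxE; apply/eqP; rewrite floor_eq.
by have := xv i Logic.I; rewrite /= in_itv.
Qed.

Lemma grid_dot n x y (u : 'cV[R]_r) : grid n x = grid n y ->
  `|dot (f x) u - dot (f y) u| <= n.+1%:R^-1 * \sum_i `|u i 0|.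
Proof.
move=> xy; rewrite -dotBl dotE mulr_sumr; apply: le_trans (ler_norm_sum _ _ _) _.
apply: ler_sum => i _; rewrite normrM ler_wpM2r// !mxE.
have /colP/(_ i) := xy; rewrite !mxE => fl.
have := floor_itv (n.+1%:R * f x i 0); rewrite fl.
have := floor_itv (n.+1%:R * f y i 0).
move: (Num.floor _) => k /andP[+ +] /andP[].
rewrite intrD => y1 y2 x1 x2.
rewrite -(@ler_pM2l _ n.+1%:R) ?ltr0n// divff ?pnatr_eq0//.
rewrite -[X in X * _](@ger0_norm _ n.+1%:R) ?ler0n// -normrM mulrBr ler_norml.
by apply/andP; split; lra.
Qed.

End grid.

Lemma ler_dist_shift (R : realType) (s t a e : R) :
  s <= (a + e) + t -> t <= (- a + e) + s -> `|s - t - a| <= e.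
Proof. by move=> st ts; rewrite ler_norml; apply/andP; split; lra. Qed.

Section exponential_tilt.
Context d dY (TZ : measurableType d) (TY : measurableType dY) (R : realType)
  (nu : probability TY R) (r : nat) (ell : TY -> R) (f : TY -> 'cV[R]_r)
  (eta : TZ -> 'cV[R]_r).
Let G zy : R := ell zy.2 + dot (f zy.2) (eta zy.1).
Hypothesis mG : measurable_fun [set: TZ * TY] G.
Let k := mdensity_kernel nu mG.

(** The term [ell] is common to both points, so the two densities differ by the exponential of
    [dot (f y) (eta z - eta z0)], which [b] bounds on [B]. *)
Lemma tilt_le z z0 B b : measurable B ->
  (forall y, B y -> dot (f y) (eta z - eta z0) <= b) ->
  (k z B <= (expR b)%:E * k z0 B)%E.
Proof.
move=> mB fb; rewrite /k /mdensity_kernel /density_kernel -ge0_integralZl//.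
- apply: ge0_le_integral => //.
  + exact/measurable_funTS/(measurable_density mG).
  + apply: measurable_funTS; apply: emeasurable_funM => //.
    exact: measurable_density.
  + move=> y By; rewrite -EFinM lee_fin -expRD ler_expR /G/=.
    by have := fb y By; rewrite dotBr; lra.
- exact/measurable_funTS/(measurable_density mG).
Qed.

Lemma tilt_gt0 z B : measurable B -> (0 < nu B)%E -> (0 < k z B)%E.
Proof.
move=> mB B0; apply: integral_expR_gt0 => //.
by apply: measurableT_comp mG _; exact: measurable_fun_pair.
Qed.

Lemma ln_tilt_le z z0 B b : measurable B -> (0 < nu B)%E ->
  (k z [set: TY] < +oo)%E -> (k z0 [set: TY] < +oo)%E ->
  (forall y, B y -> dot (f y) (eta z - eta z0) <= b) ->
  ln (fine (k z B)) <= b + ln (fine (k z0 B)).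
Proof.
move=> mB B0 koo k0oo fb.
have kfin x : (k x [set: TY] < +oo)%E -> k x B \is a fin_num.
  move=> xoo; rewrite ge0_fin_numE; last exact: measure_ge0.
  by apply: le_lt_trans xoo; apply: le_measure; rewrite ?inE.
have kgt0 x : (k x [set: TY] < +oo)%E -> 0 < fine (k x B).
  move=> xoo; apply: fine_gt0; apply/andP; split; first exact: tilt_gt0.
  by rewrite ltey_eq kfin.
rewrite -[b]expRK -lnM ?posrE ?expR_gt0 ?kgt0// ler_ln ?posrE ?mulr_gt0 ?expR_gt0 ?kgt0//.
move: (kfin _ koo) (kfin _ k0oo) (tilt_le mB fb).
by case: (k z B) (k z0 B) => [x| |] [x0| |]//= _ _; rewrite -EFinM lee_fin.
Qed.

(** The one-sided estimate is applied twice, with [z] and [z0] exchanged. *)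
Lemma ln_tilt_dist z z0 B a e : measurable B -> (0 < nu B)%E ->
  (k z [set: TY] < +oo)%E -> (k z0 [set: TY] < +oo)%E ->
  (forall y, B y -> `|dot (f y) (eta z - eta z0) - a| <= e) ->
  `|ln (fine (k z B)) - ln (fine (k z0 B)) - a| <= e.
Proof.
move=> mB B0 koo k0oo fa.
have h1 : ln (fine (k z B)) <= (a + e) + ln (fine (k z0 B)).
  apply: ln_tilt_le => // y /fa; rewrite ler_norml => /andP[_].
  by rewrite lerBlDl.
have h2 : ln (fine (k z0 B)) <= (- a + e) + ln (fine (k z B)).
  apply: ln_tilt_le => // y /fa; rewrite ler_norml => /andP[+ _].
  rewrite -(opprB (eta z)) dotNr; move: (dot _ _) => D {h1 fa}.
  by lra.
exact: ler_dist_shift h1 h2.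
Qed.

End exponential_tilt.

(** * Minimality *)

Lemma ler_distBB (R : realType) (x y a b e : R) :
  `|x - a| <= e -> `|y - b| <= e -> `|(x - y) - (a - b)| <= e + e.
Proof.
rewrite !ler_norml => /andP[xa1 xa2] /andP[yb1 yb2].
by apply/andP; split; lra.
Qed.

Lemma probability_ae_ex d (T : measurableType d) (R : realType)
  (P : probability T R) (Q : T -> Prop) :
  {ae P, forall w, Q w} -> exists w, Q w.
Proof.
move=> aeQ; have PT : P [set: T] = 1%E := probability_setT P.
have PF : ProperFilter (almost_everywhere P).
  apply: ae_properfilter_algebraOfSetsType.
  exact: (eq_ind_r (fun x => (0 < x)%E) lte01 PT).
exact: filter_ex aeQ.
Qed.

Section minimality.
Context d dY dZ dS (T : measurableType d) (TY : measurableType dY)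
  (TZ : measurableType dZ) (TS : measurableType dS) (R : realType)
  (P : probability T R) (Y : {RV P >-> TY}) (Z : T -> TZ) (S : TZ -> TS)
  (r : nat) (ell : TY -> R) (f : TY -> 'cV[R]_r) (eta : TZ -> 'cV[R]_r).
Hypotheses (mZ : measurable_fun [set: T] Z) (mf : measurable_col f)
  (f_centered : is_mean P (fun w => f (Y w)) 0)
  (f_nondeg : forall c : 'cV[R]_r,
    {ae P, forall w, (c^T *m f (Y w)) 0 0 = 0} -> c = 0).
Let nu := distribution P Y.
Hypothesis mG : measurable_fun [set: TZ * TY]
  (fun zy => ell zy.2 + dot (f zy.2) (eta zy.1)).
Let k := mdensity_kernel nu mG.
Hypotheses (cond_Y_Z : is_cond_distr P Y Z (fun z => knormalize k nu z))
  (k_ltoo : {ae P, forall w, (k (Z w) [set: TY] < +oo)%E})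
  (suff_S : sufficient_reduction P Y Z S).

(** Linear forms of [eta] are treated one at a time because the recoverable ones make up a subspace,
    to which [row_subspace_full] applies. *)
Definition recoverable (v : 'rV[R]_r) : Prop :=
  exists g : TS -> R, measurable_fun [set: TS] g /\
    {ae P, forall w, (v *m eta (Z w)) 0 0 = g (S (Z w))}.

Lemma recoverable0 : recoverable 0.
Proof.
exists (cst 0); split; first exact: measurable_cst.
by apply: aeW => w; rewrite mul0mx mxE.
Qed.

Lemma recoverableD u v : recoverable u -> recoverable v -> recoverable (u + v).
Proof.
move=> [g [mg gu]] [h [mh hv]]; exists (g \+ h); split.
  exact: measurable_funD.
by apply: filterS2 gu hv => w gu hv; rewrite mulmxDl mxE gu hv.
Qed.

Lemma recoverableZ a v : recoverable v -> recoverable (a *: v).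
Proof.
move=> [g [mg gv]]; exists (fun s => a * g s); split.
  exact: measurable_funM.
by apply: filterS gv => w gv; rewrite -scalemxAl mxE gv.
Qed.

(** At these points every cell mass is positive, so its logarithm is meaningful at each scale. *)
Definition regular (y : TY) : Prop :=
  forall n, (0 < nu (grid f n @^-1` [set grid f n y]))%E.

Lemma ae_regular : {ae P, forall w, regular (Y w)}.
Proof.
apply: ae_foralln => n.
have mg v : measurable ((grid f n \o Y) @^-1` [set v]).
  have := measurable_grid mf n v; rewrite comp_preimage => mgv.
  by rewrite -[X in measurable X]setTI; exact: measurable_funP.
by apply: filterS (ae_fiber_gt0 P mg) => w.
Qed.

(** A log-ratio of two cell masses is free of the normalizing constant, and comparison with a
    reference point removes [ell]; the limit over shrinking cells is linear in [eta]. *)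
Lemma recoverable_contrast y1 y0 : regular y1 -> regular y0 ->
  recoverable (f y1 - f y0)^T.
Proof.
move=> reg1 reg0; have [mS [K [K' [KP _ KK']]]] := suff_S.
pose cell y n := grid f n @^-1` [set grid f n y].
have mcell y n : measurable (cell y n) by exact: measurable_grid.
(* The cells around a given point are countably many, so one null set serves every [n]. *)
have Kcell y : {ae P, forall w, forall n,
    K' (S (Z w)) (cell y n) = knormalize k nu (Z w) (cell y n)}.
  apply: ae_foralln => n.
  have := cond_distr_unique mZ KP cond_Y_Z (mcell y n).
  by apply: filterS2 KK' => w <-.
pose good w := [/\ (k (Z w) [set: TY] < +oo)%E,
  forall n, K' (S (Z w)) (cell y1 n) = knormalize k nu (Z w) (cell y1 n) &
  forall n, K' (S (Z w)) (cell y0 n) = knormalize k nu (Z w) (cell y0 n)].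
have ae_good : {ae P, forall w, good w}.
  by apply: filterS3 k_ltoo (Kcell y1) (Kcell y0) => w; split.
have [w0 [k0oo _ _]] : exists w0, good w0.
  exact: probability_ae_ex ae_good.
pose z0 := Z w0.
pose c n := ln (fine (k z0 (cell y1 n))) - ln (fine (k z0 (cell y0 n))).
pose ratio n s := ln (fine (K' s (cell y1 n))) - ln (fine (K' s (cell y0 n))) - c n.
have mratio n : measurable_fun [set: TS] (ratio n).
  have mK y : measurable_fun [set: TS] (fun s => ln (fine (K' s (cell y n)))).
    apply: measurableT_comp => //; apply: measurableT_comp => //.
    exact: measurable_kernel.
  by apply: measurable_funB => //; exact: measurable_funB.
(* An upper limit is measurable in [s] even where there is no convergence, which is proved only at
   [S (Z w)] for good [w]. The last term restores the value at the reference point. *)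
pose g s := fine (limn_esup (fun n => (ratio n s)%:E)) + dot (f y1 - f y0) (eta z0).
exists g; split.
  apply: measurable_funD => //; apply: measurableT_comp => //.
  by apply: measurable_fun_limn_esup => n; exact/measurable_EFinP.
apply: filterS ae_good => w [koo K1 K0]; rewrite -/(dot _ _) /g.
set z := Z w; set u := eta z - eta z0.
(* At a good point [K'] is the normalized kernel; the logarithm of the total mass enters both terms
   of the ratio and cancels. *)
have ratioE n : ratio n (S z) =
    (ln (fine (k z (cell y1 n))) - ln (fine (k z0 (cell y1 n)))) -
    (ln (fine (k z (cell y0 n))) - ln (fine (k z0 (cell y0 n)))).
  have kT0 : (0 < k z [set: TY])%E.
    apply: tilt_gt0 => //.
    exact: (eq_ind_r (fun x => (0 < x)%E) lte01 (probability_setT nu)).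
  have kgt0 y m : (0 < nu (cell y m))%E -> 0 < fine (k z (cell y m)).
    move=> y0'; apply: fine_gt0; apply/andP; split; first exact: tilt_gt0.
    by apply: le_lt_trans koo; apply: le_measure; rewrite ?inE.
  have lnK y m : (0 < nu (cell y m))%E ->
      ln (fine (knormalize k nu z (cell y m))) =
      ln (fine (k z (cell y m))) - ln (fine (k z [set: TY])).
    move=> y0'; have kT : 0 < fine (k z [set: TY]).
      by apply: fine_gt0; rewrite kT0 koo.
    have kz : k z [set: TY] != 0%E by rewrite gt_eqF.
    have kfin : k z (cell y m) \is a fin_num.
      rewrite ge0_fin_numE; last exact: measure_ge0.
      by apply: le_lt_trans koo; apply: le_measure; rewrite ?inE.
    rewrite (knormalizeE nu (cell y m) kz koo) (fineM kfin)//=.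
    rewrite lnM ?posrE ?invr_gt0//; last exact: kgt0.
    by rewrite lnV ?posrE.
  have sub_shift (a0 a1 b0 b1 e : R) :
      (a1 - e) - (a0 - e) - (b1 - b0) = (a1 - b1) - (a0 - b0) by ring.
  rewrite -(sub_shift _ _ _ _ (ln (fine (k z [set: TY])))) /ratio.
  by rewrite (K1 n) (K0 n) (lnK y1 n (reg1 n)) (lnK y0 n (reg0 n)).
have cvg_ratio : ratio n (S z) @[n --> \oo] --> dot (f y1 - f y0) u.
  (* Within a cell [f] is nearly constant, so the log-masses at [z] and [z0] differ by [dot (f y) u]
     up to the mesh. *)
  have dist y n : regular y ->
      `|ln (fine (k z (cell y n))) - ln (fine (k z0 (cell y n))) - dot (f y) u| <=
      n.+1%:R^-1 * \sum_i `|u i 0|.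
    move=> reg; apply: (ln_tilt_dist (mcell y n) (reg n) koo k0oo) => y' yy'.
    exact: (grid_dot u yy').
  set C := \sum_i _ in dist; set L := dot _ u.
  have bound n : `|ratio n (S z) - L| <= n.+1%:R^-1 * (C + C).
    rewrite ratioE /L dotBl mulrDr.
    exact: ler_distBB (dist _ _ reg1) (dist _ _ reg0).
  have C0 : (fun n => n.+1%:R^-1 * (C + C)) @ \oo --> (0 : R).
    by rewrite -(mul0r (C + C)); apply: cvgMl; exact: cvg_harmonic.
  apply: (@squeeze_cvgr _ _ _ _ (fun n => L - n.+1%:R^-1 * (C + C))
    (fun n => L + n.+1%:R^-1 * (C + C))).
  - apply: nearW => n; have := bound n; rewrite ler_distl => /andP[-> ->].
    by [].
  - rewrite -[X in _ --> X]subr0; apply: cvgB C0; exact: cvg_cst.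
  - rewrite -[X in _ --> X]addr0; apply: cvgD C0; exact: cvg_cst.
have cvg_eratio : (ratio n (S z))%:E @[n --> \oo] --> (dot (f y1 - f y0) u)%:E.
  by apply: cvg_EFin cvg_ratio; exact: nearW.
rewrite is_cvg_limn_esupE; last by apply/cvg_ex; exists (dot (f y1 - f y0) u)%:E.
rewrite (cvg_lim _ cvg_eratio)//= /u dotBr.
by rewrite /dot subrK.
Qed.

(** If every recoverable row annihilates [c], so do the contrasts between regular points. Then
    [dot c (f (Y w))] is almost surely constant, the constant is its mean 0, and nondegeneracy gives
    [c = 0]. *)
Lemma recoverable_full v : recoverable v.
Proof.
move: v; apply: (row_subspace_full recoverable0 recoverableD recoverableZ).
move=> c cV; apply: f_nondeg.
have [w0 reg0] : exists w0, regular (Y w0).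
  exact: probability_ae_ex ae_regular.
set a := dot c (f (Y w0)).
have aea : {ae P, forall w, dot c (f (Y w)) = a}.
  apply: filterS ae_regular => w reg.
  apply/eqP; rewrite -subr_eq0 -dotBr dotC /dot.
  by rewrite (cV _ (recoverable_contrast reg reg0)) mxE.
have mfY i : measurable_fun [set: T] (fun w => f (Y w) i 0).
  exact: (measurableT_comp (mf i)).
have int i : P.-integrable [set: T] (EFin \o (fun w => f (Y w) i 0)).
  apply: integrable_fin_num => //.
  by have := f_centered i; rewrite unlock mxE => ->.
(* The mean of [dot c (f (Y w))] is computed twice: as the almost sure constant [a], then as 0 by
   linearity and centering. *)
have Ea : (\int[P]_w (dot c (f (Y w)))%:E = a%:E)%E.
  rewrite (ae_eq_integral (cst a%:E))//; last 2 first.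
  - apply/measurable_EFinP; apply: measurable_dot; last exact: mfY.
    exact: measurable_col_cst.
  - by apply: filterS aea => w -> _.
  rewrite integral_cst//.
  exact: eq_trans (congr1 (mule a%:E) (probability_setT P)) (mule1 _).
have E0 : (\int[P]_w (dot c (f (Y w)))%:E = 0)%E.
  under eq_integral do rewrite dotE -sumEFin.
  rewrite integral_sum//; last first.
    move=> i; have := integrableZl measurableT (c i 0) (int i).
    by apply: eq_integrable => // w _; rewrite /= EFinM.
  rewrite big1// => i _; under eq_integral do rewrite EFinM.
  rewrite integralZl//; last exact: int.
  by have := f_centered i; rewrite unlock mxE => ->; rewrite mule0.
have a0 : a = 0 by move: Ea; rewrite E0 => -[].
by apply: filterS aea => w; rewrite a0.
Qed.

(** The unit rows give the coordinates of [eta]; their finitely many null sets are merged. *)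
Lemma eta_recoverable : exists g : TS -> 'cV[R]_r,
  measurable_col g /\ {ae P, forall w, eta (Z w) = g (S (Z w))}.
Proof.
have [g gP] := choice (fun i : 'I_r => recoverable_full (delta_mx 0 i)).
exists (fun s => \col_i g i s); split.
  by move=> i; under eq_fun do rewrite mxE; exact: (gP i).1.
have aeg := @filter_forall _ _ _ _ (ae_filter_ringOfSetsType P) (fun i => (gP i).2).
apply: filterS aeg => w gw; apply/colP => i.
by rewrite mxE -gw -rowE mxE.
Qed.

End minimality.

(** * Sufficiency and minimality of the reduction by a basis of the column space *)

Theorem corollary2 (R : realType) (d dY : measure_display)
  (T : measurableType d) (TY : measurableType dY) (P : probability T R)
  (p q r m : nat)
  (Y : {RV P >-> TY}) (X : {RV P >-> p.-tuple R}) (H : {RV P >-> q.-tuple bool})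
  (f : TY -> 'cV[R]_r)
  (f_meas : forall i, measurable_fun [set: TY] (fun y => f y i 0))
  (f_centered : is_mean P (fun w => f (Y w)) 0)
  (f_nondeg : forall c : 'cV[R]_r,
    {ae P, forall w, (c^T *m f (Y w)) 0 0 = 0} -> c = 0)
  (Delta : 'M[R]_p) (A : 'M[R]_(p, r)) (beta : 'M[R]_(p, q))
  (mu_X : 'cV[R]_p) (mu_H : 'cV[R]_q)
  (tau0 : 'cV[R]_(dim_vech q)) (tau : 'M[R]_(dim_vech q, r))
  (Delta_posdef : posdef Delta)
  (mu_X_mean : is_mean P (fun w => colR (X w)) mu_X)
  (mu_H_mean : is_mean P (fun w => colB R (H w)) mu_H)
  (X_law : is_cond_distr P X (fun w => (H w, Y w))
    (fun hy => mvnormal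
      (mu_X + A *m f hy.2 + beta *m (colB R hy.1 - mu_H)) Delta))
  (H_law : is_cond_distr P H Y (fun y => ising (tau0 + tau *m f y)))
  (alpha : 'M[R]_(p + (q + dim_off q), m))
  (alpha_basis : is_col_basis alpha (bmx Delta A beta tau)) :
  let Z := fun w => (X w, H w) in
    minimal_sufficient_reduction P Y Z
    (linear_reduction alpha (mean_vec P (fun w => tstat (Z w)))).
Proof.
move=> Z; set c := mean_vec _ _; set S := linear_reduction alpha c.
have mf : measurable_col f by exact: f_meas.
have Dsym : Delta^T = Delta by case: Delta_posdef.
have mZ : measurable_fun [set: T] Z by exact: measurable_predictors.
have Kcond := model_cond_distr mf Dsym X_law H_law.
have Koo := model_total_ltoo mf Dsym X_law H_law.
have [_ ab] := alpha_basis.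
(* Equality of the spans lets each of [bmx] and [alpha] be computed from the other: [gam] serves
   sufficiency, [del] minimality. *)
have /submxP[gam bE] : ((bmx Delta A beta tau)^T <= alpha^T)%MS by rewrite ab.
have /submxP[del aE] : (alpha^T <= (bmx Delta A beta tau)^T)%MS by rewrite ab.
have SE z : colR (S z) = alpha^T *m tstat z - alpha^T *m c.
  by apply/colP => i; rewrite mxE tnth_mktuple mulmxBr.
have mS : measurable_fun setT S.
  apply/measurable_fun_tnthP => i.
  have : measurable_col (fun z => alpha^T *m (tstat z - c)).
    apply: measurable_col_mulmx; apply: measurable_colB.
      exact: measurable_tstat.
    exact: measurable_col_cst.
  move=> /(_ i); congr (measurable_fun _ _).
  by apply/funext => z; rewrite /= tnth_mktuple.
split.
  (* Adding [alpha^T *m c] undoes the centering, and [gam] then turns the value of the reduction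
     into [eta]. *)
  pose theta (s : m.-tuple R) := gam *m (colR s + alpha^T *m c).
  have mtheta : measurable_col theta.
    apply: measurable_col_mulmx; apply: measurable_colD.
      exact: measurable_colR.
    exact: measurable_col_cst.
  pose G' (sy : m.-tuple R * TY) :=
    log_resp Delta A beta mu_X mu_H tau0 tau (f sy.2) + dot (f sy.2) (theta sy.1).
  have mG' : measurable_fun setT G'.
    apply: measurable_funD.
      exact: (measurableT_comp (measurable_log_resp _ _ _ _ _ _ _ mf) measurable_snd).
    apply: measurable_dot.
      exact: measurable_col_comp mf measurable_snd.
    exact: measurable_col_comp mtheta measurable_fst.
  apply: (sufficient_density_kernel mG' mS _ Kcond) => z y.
  rewrite /log_joint /G' /theta /= SE subrK mulmxA -bE.
  by [].
move=> dS' TS' S' suff_S'.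
have [g [mg etaE]] := eta_recoverable mZ mf f_centered f_nondeg Kcond Koo suff_S'.
(* With [g] giving [eta] from [S'], the matrix [del] yields [alpha^T *m tstat], which is then
   centered. *)
exists (fun s => [tuple (del *m g s - alpha^T *m c) i 0 | i < m]); split.
  apply/measurable_fun_tnthP => i.
  have : measurable_col (fun s => del *m g s - alpha^T *m c).
    apply: measurable_colB; first exact: measurable_col_mulmx.
    exact: measurable_col_cst.
  move=> /(_ i); congr (measurable_fun _ _).
  by apply/funext => z; rewrite /= tnth_mktuple.
apply: filterS etaE => w etaw.
apply: eq_from_tnth => i.
by rewrite [RHS]tnth_mktuple -etaw mulmxA -aE -SE mxE.
Qed.
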